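(* For every positive integer $n$ there is a subgroup $G$ of $U$ of index $n$ that is generated by rotations.
   Context: The group $U$. Let $\tau=(1+\sqrt5)/2$. Use the Klein model of hyperbolic 3-space $H^3$ given by the open ball of radius $R=\tau^{3/2}$ centred at the origin of $\mathbb R^3$. Let $D_0$ be the regular dodecahedron with vertices $(\pm1,\pm1,\pm1)$, $(\pm\tau^{-1},0,\pm\tau)$, $(\pm\tau,\pm\tau^{-1},0)$, $(0,\pm\tau,\pm\tau^{-1})$; for this $R$ it is a regular hyperbolic dodecahedron all of whose dihedral angles are $90^\circ$. $U$ is the discrete group of orientation-preserving isometries of $H^3$ generated by the $90^\circ$ hyperbolic rotations $a,b,c$ about the lines $\{(t,0,\tau)\}$, $\{(\tau,t,0)\}$, $\{(0,\tau,t)\}$ respectively (each contains an edge of $D_0$). $U$ is the orbifold group of the hyperbolic orbifold with underlying space $S^3$ and singular set the Borromean rings with singular angle $90^\circ$; $D_0$ is a fundamental domain for $U$. With suitable choices of the senses of rotation and with $\overline g=g^{-1}$, $$U=\langle a,b,c\mid a\,b\overline c\overline b c=b\overline c\overline b c\,a,\ b\,c\overline a\overline c a=c\overline a\overline c a\,b,\ c\,a\overline b\overline a b=a\overline b\overline a b\,c,\ a^4,\ b^4,\ c^4\rangle.$$ A rotation in $U$ is a non-identity element of $U$ that fixes some hyperbolic line (its axis) pointwise. A subgroup is generated by rotations if it is generated by the rotations of $U$ that it contains. *)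

(* Defs.v *)
From HB Require Import structures.
From mathcomp Require Import all_boot all_order all_algebra.
From mathcomp Require Import all_classical all_reals all_analysis.

Set Implicit Arguments.
Unset Strict Implicit.
Unset Printing Implicit Defensive.

Import Order.TTheory GRing.Theory Num.Theory.

Local Open Scope classical_set_scope.
Local Open Scope card_scope.
Local Open Scope ring_scope.

(* Subgroups of a possibly infinite group, as classical sets.                 *)
Section Subgroups.
Variable gT : groupType.
Implicit Types (A G H : set gT) (g : gT).
Local Open Scope group_scope.

Definition is_subgroup G : Prop :=
  [/\ G 1, (forall g h, G g -> G h -> G (g * h)) & (forall g, G g -> G g^-1)].

Definition generated A : set gT := smallest is_subgroup A.

Definition left_coset g H : set gT := [set g * h | h in H].

Definition has_index G H (n : nat) : Prop :=
  [set left_coset g H | g in G] #= `I_n.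

End Subgroups.

Section KleinModel.
Variable R : realType.
Implicit Types p u v : 'rV[R]_3.

Definition tau : R := (1 + Num.sqrt 5) / 2.

Definition klein_radius : R := tau `^ (3 / 2).

(* The Euclidean inner product is spelled out because the library norm on     *)
(* row vectors is the sup norm.                                               *)
Definition dot u v : R := \sum_(i < 3) u 0 i * v 0 i.

Definition H3 : Type := {p : 'rV[R]_3 | dot p p < klein_radius ^+ 2}.

Definition arcosh (t : R) : R := ln (t + Num.sqrt (t ^+ 2 - 1)).

(* Distance of the Klein model in the ball of that radius, curvature -1. *)
Definition hdist (x y : H3) : R :=
  let p := \val x in let q := \val y in
  arcosh ((klein_radius ^+ 2 - dot p q) /
    Num.sqrt ((klein_radius ^+ 2 - dot p p) * (klein_radius ^+ 2 - dot q q))).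

(* The Riemannian metric tensor of the same model at the point p. Hyperbolic  *)
(* angles are measured with it; they differ in general from Euclidean ones.   *)
Definition klein_metric p u v : R :=
  dot u v / (klein_radius ^+ 2 - dot p p)
  + dot p u * dot p v / (klein_radius ^+ 2 - dot p p) ^+ 2.

Definition hisometric (f : H3 -> H3) : Prop :=
  bijective f /\ forall x y, hdist (f x) (f y) = hdist x y.

Record hisometry := HIsometry {
  hisometry_fun :> H3 -> H3;
  hisometry_proof : `[< hisometric hisometry_fun >] }.

HB.instance Definition _ := [isSub for hisometry_fun].
HB.instance Definition _ := gen_eqMixin hisometry.
HB.instance Definition _ := gen_choiceMixin hisometry.

Lemma hisometryP (g : hisometry) : hisometric g.
Proof. by case: g => f /= /asboolP. Qed.

Lemma hisometry_ext (g h : hisometry) : g =1 h -> g = h.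
Proof. by move=> gh; apply: val_inj; apply/funext. Qed.

Lemma hisometric_id : hisometric id.
Proof. by split=> //; exists id. Qed.

Lemma hisometric_comp f g :
  hisometric f -> hisometric g -> hisometric (f \o g).
Proof.
move=> [bf df] [bg dg]; split; first exact: bij_comp.
by move=> x y /=; rewrite df dg.
Qed.

Lemma hisometric_inv f : hisometric f ->
  {f' | hisometric f' /\ cancel f f' /\ cancel f' f}.
Proof.
move=> [bf df]; apply: cid; case: bf => f' fK f'K; exists f'; split=> //.
by split=> [|x y]; [exists f | rewrite -df !f'K].
Qed.

Definition hisometry_one : hisometry := HIsometry (asboolT hisometric_id).

Definition hisometry_mul (g h : hisometry) : hisometry :=
  HIsometry (asboolT (hisometric_comp (hisometryP g) (hisometryP h))).

Definition hisometry_inv (g : hisometry) : hisometry :=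
  HIsometry (asboolT (proj1 (svalP (hisometric_inv (hisometryP g))))).

Lemma hisometry_mulA : associative hisometry_mul.
Proof. by move=> f g h; apply: hisometry_ext. Qed.

Lemma hisometry_mul1 : left_id hisometry_one hisometry_mul.
Proof. by move=> g; apply: hisometry_ext. Qed.

Lemma hisometry_mulr1 : right_id hisometry_one hisometry_mul.
Proof. by move=> g; apply: hisometry_ext. Qed.

Lemma hisometry_mulV : left_inverse hisometry_one hisometry_inv hisometry_mul.
Proof.
move=> g; apply: hisometry_ext => x.
exact: (proj1 (proj2 (svalP (hisometric_inv (hisometryP g))))).
Qed.

Lemma hisometry_mulrV : right_inverse hisometry_one hisometry_inv hisometry_mul.
Proof.
move=> g; apply: hisometry_ext => x.
exact: (proj2 (proj2 (svalP (hisometric_inv (hisometryP g))))).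
Qed.

HB.instance Definition _ := isGroup.Build hisometry
  hisometry_mulA hisometry_mul1 hisometry_mulr1
  hisometry_mulV hisometry_mulrV.

(* Hyperbolic lines are the nonempty traces on the ball of Euclidean lines.   *)
Definition line_through p v : set H3 := [set x | exists t, \val x = p + t *: v].

Definition is_hline (L : set H3) : Prop :=
  L !=set0 /\ exists p v, v != 0 /\ L = line_through p v.

Definition fixes_pointwise (g : hisometry) (L : set H3) : Prop :=
  forall x, L x -> g x = x.

(* The segment from p to x is perpendicular to L at p. Geodesics are          *)
(* Euclidean segments, so the initial direction of the one from p to x is     *)
(* x - p.                                                                     *)
Definition perpendicular_at (L : set H3) (p x : H3) : Prop :=
  forall q : H3, L q -> klein_metric (\val p) (\val q - \val p) (\val x - \val p) = 0.

(* Rotation by 90 degrees about L, in one of the two senses: every segment    *)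
(* perpendicular to L at a point p of L is sent to a segment from p making a  *)
(* right angle with it. This forces g to preserve orientation, since an       *)
(* orientation-reversing isometry fixing L pointwise is the reflection in a   *)
(* plane containing L, which fixes some of these segments.                    *)
Definition rotation90_about (L : set H3) (g : hisometry) : Prop :=
  fixes_pointwise g L /\
  forall p x : H3, L p -> ~ L x -> perpendicular_at L p x ->
    klein_metric (\val p) (\val x - \val p) (\val (g x) - \val p) = 0.

Definition vec3 (x y z : R) : 'rV[R]_3 := \row_(i < 3) [:: x; y; z]`_i.

Definition axis_a : set H3 := line_through (vec3 0 0 tau) (vec3 1 0 0).
Definition axis_b : set H3 := line_through (vec3 tau 0 0) (vec3 0 1 0).
Definition axis_c : set H3 := line_through (vec3 0 tau 0) (vec3 0 0 1).

(* The two 90 degree rotations about a line are inverse to each other, so     *)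
(* taking both of them for each axis amounts to taking one, in either sense.  *)
Definition U : set hisometry :=
  generated [set g | [\/ rotation90_about axis_a g,
                         rotation90_about axis_b g |
                         rotation90_about axis_c g]].

Definition is_rotation (g : hisometry) : Prop :=
  [/\ U g, g <> 1%g & exists2 L, is_hline L & fixes_pointwise g L].

Definition generated_by_rotations (G : set hisometry) : Prop :=
  G = generated (G `&` is_rotation).

End KleinModel.

Arguments axis_a : clear implicits.
Arguments axis_b : clear implicits.
Arguments axis_c : clear implicits.
Arguments U : clear implicits.

(* Main.v *)
Require Import Defs.
From mathcomp Require Import all_boot all_order all_algebra.
From mathcomp Require Import all_classical all_reals all_analysis.
From mathcomp Require Import zify ring lra.

(** Adding the relations c = 1, a^2 = 1 and b^2 = 1 to U leaves the free product of
    two groups of order 2, the infinite dihedral group: it acts on the integers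
    with a as k |-> - k, b as k |-> 1 - k and c as the identity. Given this action,
    the stabiliser G of n Z has index n, and it is generated by rotations: the
    kernel of the action is the normal closure of c, a^2 and b^2, which are
    rotations or trivial, as are their conjugates; and modulo the kernel G is
    generated by the two reflections k |-> - k and k |-> n - k, realised by a and
    by a conjugate of a or b. This is dihedral_index_subgroup. It remains to show
    that the action exists, that is, that no relation of U obstructs it.

    The action is built by counting crossings with a family of hyperbolic planes
    that U preserves. In homogeneous coordinates (x, y, z; w) of the Klein model U
    acts linearly, preserving the form x^2 + y^2 + z^2 - tau^3 w^2 and the lattice
    of vectors with golden integer coordinates.
    A wall is a lattice vector of norm 2 satisfying congruences modulo 4, chosen so
    that a and b send each wall to the opposite of a wall while c sends walls to walls.
    A wall determines a plane together with a positive side. Only finitely many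
    walls separate two given points, because the conjugate form is positive
    definite (finite_separating_walls), so one can form the signed number
    crossings x y of walls crossed from x to y. It is additive along paths and
    satisfies crossings (g x) (g y) = s * crossings x y with a sign s depending on
    g in U, equal to -1 for a and b and to 1 for c. Let xa be a point of the axis
    of a. Then k |-> crossings xa (g xa) + s * k is an action of
    U on the integers, in which c acts trivially because it fixes a point, a is the
    reflection in 0, and b the reflection in crossings xa xb, with xb on the
    axis of b. A finite enumeration shows that this last number is
    positive (crossings_axes). Division by 2 * crossings xa xb normalizes the action.

    The generators of U are given as isometries of the distance which turn
    perpendiculars to an axis by a right angle. On the hyperboloid such a map
    preserves the Lorentz form, and rotation90_aboutP shows that it is one of two
    linear quarter turns; exists_rotation90 shows that these do occur. *)

Set Implicit Arguments.
Unset Strict Implicit.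
Unset Printing Implicit Defensive.

Import Order.TTheory GRing.Theory Num.Theory.

Local Open Scope classical_set_scope.
Local Open Scope card_scope.
Local Open Scope ring_scope.

(** * Subgroups generated by a set, integer powers *)

Section GeneratedSubgroups.
Variable gT : groupType.
Implicit Types (A G : set gT) (g h u : gT).

Lemma subgroup1 G : is_subgroup G -> G 1%g. Proof. by case. Qed.

Lemma subgroupM G : is_subgroup G -> forall g h, G g -> G h -> G (g * h)%g.
Proof. by case. Qed.

Lemma subgroupV G : is_subgroup G -> forall g, G g -> G g^-1%g.
Proof. by case. Qed.

Lemma sub_generated A : A `<=` generated A.
Proof. exact: sub_gen_smallest. Qed.

Lemma generated_sub A G : is_subgroup G -> A `<=` G -> generated A `<=` G.
Proof. exact: smallest_sub. Qed.

Lemma generated_subgroup A : is_subgroup (generated A).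
Proof.
split=> [|g h Ag Ah|g Ag] M [Msub AM]; first exact: (subgroup1 Msub).
  by apply: (subgroupM Msub); [apply: Ag|apply: Ah].
by apply: (subgroupV Msub); apply: Ag.
Qed.

Lemma generatedJ A u : (forall g, A g -> generated A (u * g * u^-1)%g) ->
  forall g, generated A g -> generated A (u * g * u^-1)%g.
Proof.
move=> Au; apply: generated_sub => //; have subA := generated_subgroup A.
split=> [|g h Ag Ah|g Ag] /=.
- by rewrite mulg1 mulgV; apply: (subgroup1 subA).
- suff -> : (u * (g * h) * u^-1 = (u * g * u^-1) * (u * h * u^-1))%g.
    exact: (subgroupM subA).
  by rewrite !mulgA mulgVK.
- suff -> : (u * g^-1 * u^-1 = (u * g * u^-1)^-1)%g by exact: (subgroupV subA).
  by rewrite !invgM invgK mulgA.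
Qed.

Definition zpow g (i : int) : gT :=
  match i with Posz n => (g ^+ n)%g | Negz n => (g^-1 ^+ n.+1)%g end.

Lemma zpowS g i : zpow g (i + 1) = (zpow g i * g)%g.
Proof.
case: i => [n|[|n]]; first by rewrite -PoszD addn1 /= expgSr.
  by rewrite /= expg1 mulVg.
rewrite [Negz n.+1 + 1](_ : _ = Negz n) /=; last by lia.
by rewrite [in RHS]expgSr mulgVK.
Qed.

Lemma zpowB1 g i : zpow g (i - 1) = (zpow g i * g^-1)%g.
Proof. by rewrite -[i in RHS](subrK 1) zpowS mulgK. Qed.

Lemma zpowD g i (n : nat) : zpow g (i + n%:Z) = (zpow g i * zpow g n)%g.
Proof.
elim: n => [|n IHn]; first by rewrite addr0 /= mulg1.
by rewrite -addn1 PoszD addrA !zpowS IHn mulgA.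
Qed.

Lemma zpowB g i (n : nat) : zpow g (i - n%:Z) = (zpow g i * (zpow g n)^-1)%g.
Proof. by rewrite -[i in RHS](subrK n%:Z) zpowD mulgK. Qed.

End GeneratedSubgroups.

(** * Finite-index subgroups from a map onto the infinite dihedral group *)

Section DihedralQuotient.
Variables (gT : groupType) (gens rot : set gT) (a b : gT).
(** An action of U on Z by isometries: g acts as k |-> t g + e g * k with e g a
    sign, and tM, eM say that composition is respected. The reflections a and b
    have the centres 0 and 1/2, so that b * a is the translation by 1. *)
Variables t e : gT -> int.
Let U := generated gens.
Hypothesis tM : forall g h, U g -> U h -> t (g * h)%g = t g + e g * t h.
Hypothesis eM : forall g h, U g -> U h -> e (g * h)%g = e g * e h.
Hypothesis rotU : rot `<=` U.
Hypothesis rotJ : forall u g, U u -> rot g -> rot (u * g * u^-1)%g.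
Hypotheses (rota : rot a) (rotb : rot b).
Hypotheses (ta : t a = 0) (ea : e a = -1) (tb : t b = 1) (eb : e b = -1).
Hypothesis rotaa : (a * a = 1)%g \/ rot (a * a)%g.
Hypothesis rotbb : (b * b = 1)%g \/ rot (b * b)%g.
Hypothesis gensP : forall g, gens g -> [\/ g = a \/ g = a^-1%g,
  g = b \/ g = b^-1%g | [/\ g = 1%g \/ rot g, t g = 0 & e g = 1]].

Let Usub : is_subgroup U := generated_subgroup gens.
Let U1 : U 1%g := subgroup1 Usub.
Let UM g h : U g -> U h -> U (g * h)%g := @subgroupM _ _ Usub g h.
Let UV g : U g -> U g^-1%g := @subgroupV _ _ Usub g.
Let Ua : U a := rotU rota.
Let Ub : U b := rotU rotb.

Let e1 : e 1%g = 1.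
Proof. by have := eM U1 Ua; rewrite mul1g ea; lia. Qed.

Let t1 : t 1%g = 0.
Proof. by have := tM U1 U1; rewrite mul1g e1; lia. Qed.

Let eV g : U g -> e g * e g^-1%g = 1.
Proof. by move=> Ug; rewrite -eM ?mulgV //; apply: UV. Qed.

Let tV g : U g -> t g + e g * t g^-1%g = 0.
Proof. by move=> Ug; rewrite -tM ?mulgV //; apply: UV. Qed.

Let tVE g : U g -> t g^-1%g = - (e g^-1%g * t g).
Proof.
move=> Ug; apply/eqP; rewrite -addr_eq0 -(mulr0 (e g^-1%g)) -(tV Ug).
by rewrite mulrDr mulrA [_ * e g]mulrC eV // mul1r addrC.
Qed.

(** This is the whole kernel of the action, by normal_formP below; defining it
    by generators makes it visibly generated by rotations. *)
Let ker : set gT := generated [set g | [/\ rot g, t g = 0 & e g = 1]].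
Let kersub : is_subgroup ker := generated_subgroup _.

Let kerP g : ker g -> [/\ U g, t g = 0 & e g = 1].
Proof.
move: g; apply: generated_sub => [|g [/rotU]] //.
split=> [|g h [Ug tg eg] [Uh th eh]|g [Ug tg eg]] //.
  by split; [exact: UM|rewrite tM// tg eg th|rewrite eM// eg eh].
split; first exact: UV.
  by have := tV Ug; rewrite tg eg; lia.
by have := eV Ug; rewrite eg; lia.
Qed.

Let kerJ u g : U u -> ker g -> ker (u * g * u^-1)%g.
Proof.
move=> Uu; move: g; apply: generatedJ => g [rg tg eg].
apply: sub_generated; have Ug := rotU rg; have UVu := UV Uu.
split; first exact: rotJ.
  rewrite !(tM, eM) //; last exact: UM.
  by rewrite tg eg mulr0 addr0 mulr1 tV.
by rewrite !eM // ?eg ?mulr1 ?eV //; apply: UM.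
Qed.

Let ker_aa : ker (a * a)%g.
Proof.
case: rotaa => [->|raa]; first exact: (subgroup1 kersub).
by apply: sub_generated; split=> //; rewrite ?tM ?eM // ea ?ta.
Qed.

Let ker_bb : ker (b * b)%g.
Proof.
case: rotbb => [->|rbb]; first exact: (subgroup1 kersub).
by apply: sub_generated; split=> //; rewrite ?tM ?eM // eb ?tb.
Qed.

Let W i : gT := zpow (b * a)%g i.

Let UW i : U (W i).
Proof.
have Upow g n : U g -> U (g ^+ n)%g.
  by move=> Ug; elim: n => [|n IHn]; [exact: U1|rewrite expgS; apply: UM].
by case: i => n; apply: Upow; [|apply: UV]; apply: UM.
Qed.

Let eW i : e (W i) = 1.
Proof.
have Uba : U (b * a)%g by apply: UM.
elim/int_ind: i => [|n IHn|n IHn]; first exact: e1.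
- by rewrite -addn1 PoszD /W zpowS eM // -/(W _) IHn eM // ea eb.
- rewrite -addn1 PoszD opprD /W zpowB1 eM //; last exact: UV.
  by rewrite -/(W _) IHn; have := eV Uba; rewrite [e (b * a)%g]eM // ea eb; lia.
Qed.

Let tW i : t (W i) = i.
Proof.
have Uba : U (b * a)%g by apply: UM.
have tba : t (b * a)%g = 1 by rewrite tM // tb eb ta.
have eba : e (b * a)%g = 1 by rewrite eM // ea eb.
elim/int_ind: i => [|n IHn|n IHn]; first exact: t1.
- by rewrite -addn1 PoszD /W zpowS tM // -/(W _) IHn eW tba; lia.
- rewrite -addn1 PoszD opprD /W zpowB1 tM //; last exact: UV.
  by rewrite -/(W _) IHn eW; have := tV Uba; rewrite tba eba; lia.
Qed.

(** Modulo ker the squares of a and b vanish, so the quotient is generated by two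
    involutions: each of its elements is a power of b * a, or such a power times a.
    The normal form is propagated by right multiplication with the generators,
    which moves past the factor in the normal subgroup ker. *)
Let normal_form (g : gT) : Prop :=
  exists i k, ker k /\ (g = W i * k \/ g = W i * a * k)%g.

Let normal_formM g k : normal_form g -> ker k -> normal_form (g * k)%g.
Proof.
move=> [i [l [kl gE]]] kk; exists i, (l * k)%g; split; first exact: (subgroupM kersub).
by case: gE => ->; [left|right]; rewrite !mulgA.
Qed.

Let normal_formMr g x : U x -> normal_form g ->
  (forall i, normal_form (W i * x)%g) ->
  (forall i, normal_form (W i * a * x)%g) -> normal_form (g * x)%g.
Proof.
move=> Ux [i [k [kk gE]]] nf nfa.
have kkx : ker (x^-1 * k * x)%g.
  by rewrite -{2}[x]invgK; apply: kerJ => //; apply: UV.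
have Ek h : (h * k * x = h * x * (x^-1 * k * x))%g.
  by rewrite !mulgA mulgK.
by case: gE => ->; rewrite Ek; apply: normal_formM.
Qed.

Let normal_form_a g : normal_form g -> normal_form (g * a)%g.
Proof.
move=> nfg; apply: normal_formMr => // i.
  exists i, 1%g; split; first exact: (subgroup1 kersub).
  by right; rewrite mulg1.
by exists i, (a * a)%g; split=> //; left; rewrite mulgA.
Qed.

Let normal_form_b g : normal_form g -> normal_form (g * b)%g.
Proof.
move=> nfg; apply: normal_formMr => // i.
  (* (ba)^i b = (ba)^(i+1) a (aa)^-1 *)
  exists (i + 1), (a * a)^-1%g; split; first exact: (subgroupV kersub).
  by right; rewrite /W zpowS invgM !mulgA !mulgK.
(* (ba)^i a b = (ba)^(i-1) (b (aa) b^-1) (bb) *)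
exists (i - 1), (b * (a * a) * b^-1 * (b * b))%g; split.
  by apply: (subgroupM kersub) => //; apply: kerJ.
by left; rewrite /W zpowB1 invgM !mulgA !mulgVK.
Qed.

Let normal_form_cancel g x : ker (x * x)%g ->
  (forall h, normal_form h -> normal_form (h * x)%g) ->
  normal_form g -> normal_form (g * x^-1)%g.
Proof.
move=> kxx nfx nfg.
have -> : (g * x^-1 = g * x * (x * x)^-1)%g by rewrite invgM !mulgA mulgK.
by apply: normal_formM; [apply: nfx|apply: (subgroupV kersub)].
Qed.

Let normal_formP u : U u -> normal_form u.
Proof.
move: u; suff UP : U `<=` [set u | forall g, normal_form g ->
    normal_form (g * u)%g /\ normal_form (g * u^-1)%g].
  move=> u /UP /(_ 1%g) []; rewrite ?mul1g //.
  exists 0, 1%g; split; first exact: (subgroup1 kersub).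
  by left; rewrite /W mulg1.
apply: generated_sub.
  split=> [g nfg|g h gP hP k nfk|g gP k nfk].
  - by rewrite invg1 mulg1.
  - rewrite invgM !mulgA; split.
      by have [/hP[]] := gP _ nfk.
    by have [_ /gP[]] := hP _ nfk.
  - by rewrite invgK; have [] := gP _ nfk.
move=> u /gensP[[->|->]|[->|->]|[u1 tu eu]] g nfg; rewrite ?invgK.
- by split; [exact: normal_form_a|apply: normal_form_cancel].
- by split; [apply: normal_form_cancel|exact: normal_form_a].
- by split; [exact: normal_form_b|apply: normal_form_cancel].
- by split; [apply: normal_form_cancel|exact: normal_form_b].
- have kku : ker u.
    by case: u1 => [->|ru]; [exact: (subgroup1 kersub)|apply: sub_generated].
  by split; apply: normal_formM => //; apply: (subgroupV kersub).
Qed.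

(** The subgroup is the stabiliser of the set n Z. It contains ker, the reflection
    a and the reflection k |-> n - k, which is a conjugate of a or of b according
    to the parity of n; these generate it, since a composed with that reflection
    translates by n. The index is n because the translates n Z + i are permuted
    transitively. *)
Lemma dihedral_index_subgroup (n : nat) : (0 < n)%N -> exists G : set gT,
  [/\ is_subgroup G, G `<=` U, has_index U G n & G = generated (G `&` rot)].
Proof.
move=> n0; pose G := [set g | U g /\ (n%:Z %| t g)%Z].
have Gsub : is_subgroup G.
  split=> [|g h [Ug ng] [Uh nh]|g [Ug ng]]; first by split; rewrite ?t1 ?dvdz0.
    by split; [exact: UM|rewrite tM // rpredD // dvdz_mull].
  split; first exact: UV.
  by rewrite tVE // rpredN dvdz_mull.
have coset_eq g h : U g -> U h -> left_coset g G = left_coset h G <->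
    (n%:Z %| t g - t h)%Z.
  move=> Ug Uh.
  have tVM : t (h^-1 * g)%g = e h^-1%g * (t g - t h).
    by rewrite tM ?tVE //; [rewrite mulrBr addrC|apply: UV].
  have tVMd : (n%:Z %| t g - t h)%Z = (n%:Z %| t (h^-1 * g)%g)%Z.
    rewrite tVM; apply/idP/idP; first exact: dvdz_mull.
    move/(dvdz_mull (e h)); rewrite mulrA eV // mul1r //.
  rewrite tVMd; split=> [|nhg].
    move=> /seteqP[+ _] => /(_ g)[|k [Uk nk] <-].
      by exists 1%g; [exact: (subgroup1 Gsub)|rewrite mulg1].
    by rewrite mulKg.
  have Gk : G (h^-1 * g)%g by split=> //; apply: UM => //; apply: UV.
  apply/seteqP; split=> _ [k Gk' <-].
    by exists (h^-1 * g * k)%g; [apply: (subgroupM Gsub)|rewrite !mulgA mulgV mul1g].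
  exists ((h^-1 * g)^-1 * k)%g; first by apply: (subgroupM Gsub) => //; apply: (subgroupV Gsub).
  by rewrite invgM invgK !mulgA mulgV mul1g.
exists G; split=> //; first by move=> g [].
  rewrite /has_index.
  pose c (i : nat) := left_coset (W i) G.
  have -> : [set left_coset g G | g in U] = c @` `I_n.
    apply/seteqP; split=> [_ [g Ug <-]|_ [i _ <-]]; last by exists (W i).
    have nZ0 : n%:Z != 0 by lia.
    have tg0 := modz_ge0 (t g) nZ0; have tgn := ltz_mod (t g) nZ0.
    exists `|(t g %% n)%Z|%N => /=; first by lia.
    apply/coset_eq => //; rewrite tW gez0_abs //.
    by rewrite {2}(divz_eq (t g) n) opprD addrCA subrr addr0 -mulNr dvdz_mull.
  apply: inj_card_eq => i j; rewrite !inE /= => iln jln.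
  move=> /coset_eq; rewrite !tW => /(_ (UW _) (UW _)).
  by rewrite -eqz_mod_dvd !modz_small //= => /eqP[].
pose G' := generated (G `&` rot).
have G'sub : is_subgroup G' := generated_subgroup _.
have kerG' : ker `<=` G'.
  apply: generated_sub => // g [rg tg eg]; apply: sub_generated; split=> //.
  by split; [exact: rotU|rewrite tg dvdz0].
have G'a : G' a by apply: sub_generated; split=> //; split=> //; rewrite ta dvdz0.
have G'Wn : G' (W n).
  (* r is the reflection k |-> n - k *)
  have [r [rr tr er]] : exists r, [/\ rot r, t r = n & e r = -1].
    have tJ x i : U x -> e x = -1 -> t (W i * x * (W i)^-1)%g = i + i + t x.
      move=> Ux ex; have UVW := UV (UW i); rewrite !(tM, eM) //; last exact: UM.
      by have := tV (UW i); rewrite eW ex tW; lia.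
    have eJ x i : U x -> e (W i * x * (W i)^-1)%g = e x.
      move=> Ux; have UVW := UV (UW i); rewrite !eM //; last exact: UM.
      by have := eV (UW i); rewrite eW; lia.
    rewrite -(odd_double_half n); case: (odd n).
      exists (W n./2 * b * (W n./2)^-1)%g; split; first exact: rotJ.
        by rewrite tJ // tb -addnn; lia.
      by rewrite eJ.
    exists (W n./2 * a * (W n./2)^-1)%g; split; first exact: rotJ.
      by rewrite tJ // ta -addnn; lia.
    by rewrite eJ.
  have Ur := rotU rr.
  have [i [k [kk]]] := normal_formP (UM Ur Ua).
  have [Uk tk ek] := kerP kk.
  have tra : t (r * a)%g = n by rewrite tM // tr ta; lia.
  have era : e (r * a)%g = 1 by rewrite eM // er ea.
  case=> raE.
    move: tra; rewrite raE tM // tW tk mulr0 addr0 => <-.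
    have -> : W i = (r * a * k^-1)%g by rewrite raE mulgK.
    apply: (subgroupM G'sub) => //; last by apply: (subgroupV G'sub); apply: kerG'.
    apply: (subgroupM G'sub) => //; apply: sub_generated; split=> //; split=> //.
    by rewrite tr dvdzz.
  by move: era; rewrite raE eM //; [rewrite eM // eW ea ek|apply: UM].
have G'W i : (n%:Z %| i)%Z -> G' (W i).
  move=> /dvdzP[j ->]; elim/int_ind: j => [|j IHj|j IHj].
  - by rewrite mul0r; apply: (subgroup1 G'sub).
  - by rewrite -addn1 PoszD mulrDl mul1r /W zpowD; apply: (subgroupM G'sub).
  - rewrite -addn1 PoszD opprD mulrDl mulN1r /W zpowB; apply: (subgroupM G'sub) => //.
    exact: (subgroupV G'sub).
apply/seteqP; split=> [g [Ug ng]|]; last by apply: generated_sub => // g [].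
have [i [k [kk gE]]] := normal_formP Ug; have [Uk tk ek] := kerP kk.
have ni : (n%:Z %| i)%Z.
  move: ng; case: gE => ->; rewrite tM //; last exact: UM.
    by rewrite tW tk mulr0 addr0.
  by rewrite tM // tW ta tk !mulr0 !addr0.
case: gE => ->; apply: (subgroupM G'sub) => //; try exact: G'W; try exact: kerG'.
by apply: (subgroupM G'sub) => //; apply: G'W.
Qed.

End DihedralQuotient.

(** * The golden ratio *)

Section GoldenRatio.
Variable R : realType.
Local Notation tau := (tau R).

Lemma tau_sqr : tau ^+ 2 = tau + 1.
Proof.
have s5 : Num.sqrt (5 : R) ^+ 2 = 5 by rewrite sqr_sqrtr.
by rewrite /Defs.tau; move: s5; set s := Num.sqrt _ => s5; field: s5.
Qed.

Lemma tau_gt0 : 0 < tau.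
Proof. by rewrite /Defs.tau divr_gt0 // ltr_wpDr // sqrtr_ge0. Qed.

Lemma tau_gt : 8 / 5 < tau.
Proof. by have := tau_sqr; have := tau_gt0; nra. Qed.

Lemma tau_lt : tau < 34 / 21.
Proof. by have := tau_sqr; have := tau_gt0; nra. Qed.

Lemma klein_radius_sqr : klein_radius R ^+ 2 = 2 * tau + 1.
Proof.
rewrite /klein_radius -powR_mulrn ?powR_ge0 // -powRrM.
rewrite (_ : 3 / 2 * 2%:R = 3%:R :> R); last by field.
rewrite powR_mulrn ?(ltW tau_gt0) //.
by rewrite exprS tau_sqr mulrDr -expr2 tau_sqr; ring.
Qed.

End GoldenRatio.

(** * The hyperboloid over the Klein ball, and quarter turns *)

(** Read (A x, B x) as a vector in the plane and (A' x, B' x) as its image under a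
    map that keeps inner products. The vectors of x1, x2, x3 point along the first
    axis, the diagonal and the second axis. If each is sent to a perpendicular
    vector then each is turned by a right angle; the diagonal one is orthogonal
    to neither of the others, so all three are turned in the same sense, and they determine
    the image of every other vector. *)
Lemma planar_quarter_turn (F : fieldType) (X : Type) (A B A' B' : X -> F) (x1 x2 x3 : X)
    (s1 s2 s3 : F) :
  s1 != 0 -> s2 != 0 -> s3 != 0 -> A x1 = s1 -> B x1 = 0 -> A x2 = s2 -> B x2 = s2 ->
  A x3 = 0 -> B x3 = s3 ->
  (forall x y : X, A' x * A' y + B' x * B' y = A x * A y + B x * B y) ->
  A' x1 * A x1 + B' x1 * B x1 = 0 -> A' x2 * A x2 + B' x2 * B x2 = 0 ->
  A' x3 * A x3 + B' x3 * B x3 = 0 ->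
  (forall x : X, A' x = - B x /\ B' x = A x) \/ (forall x : X, A' x = B x /\ B' x = - A x).
Proof.
move=> n1 n2 n3 A1 B1 A2 B2 A3 B3 AB.
rewrite A1 B1 A2 B2 A3 B3 !mulr0 addr0 add0r -mulrDl.
move=> /eqP + /eqP + /eqP; rewrite !mulf_eq0 (negPf n1) (negPf n2) (negPf n3) !orbF.
move=> /eqP A'1 /eqP A'2 /eqP B'3.
have {}A'2 : A' x2 = - B' x2 by apply/eqP; rewrite -addr_eq0 A'2.
have B'11 : B' x1 ^+ 2 = s1 ^+ 2.
  by have := AB x1 x1; rewrite A'1 A1 B1 !mul0r add0r addr0 -!expr2.
have B'12 : B' x1 * B' x2 = s1 * s2.
  by have := AB x1 x2; rewrite A'1 A1 B1 A2 !mul0r add0r addr0.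
have A'32 : A' x3 * A' x2 = s3 * s2.
  by have := AB x3 x2; rewrite B'3 A3 B3 B2 !mul0r add0r addr0.
have B'x x : B' x * B' x1 = A x * s1.
  by have := AB x x1; rewrite A'1 A1 B1 !mulr0 add0r addr0.
have A'x x : A' x * A' x3 = B x * s3.
  by have := AB x x3; rewrite B'3 A3 B3 !mulr0 add0r addr0.
move/eqP: B'11; rewrite eqf_sqr => /orP[] /eqP B'1; [left|right] => x.
  have B'2 : B' x2 = s2 by apply: (mulfI n1); rewrite -B'12 B'1.
  have A'3 : A' x3 = - s3.
    by apply: (mulIf n2); rewrite mulNr -A'32 A'2 B'2 mulrN opprK.
  split; last by apply: (mulIf n1); rewrite -B'x B'1.
  by apply: (mulIf n3); rewrite mulNr -A'x A'3 mulrN opprK.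
have B'2 : B' x2 = - s2.
  by apply: (mulfI n1); rewrite mulrN -B'12 B'1 mulNr opprK.
have A'3 : A' x3 = s3 by apply: (mulIf n2); rewrite -A'32 A'2 B'2 opprK.
split; last by apply: (mulIf n1); rewrite mulNr -B'x B'1 mulrN opprK.
by apply: (mulIf n3); rewrite -A'x A'3.
Qed.

Section LorentzSpace.
Variable R : realType.
Local Notation k := (klein_radius R ^+ 2).
Local Notation V := ('rV[R]_3 * R^o)%type.
Local Notation H3 := (H3 R).
Implicit Types (u v w : V) (x y p q : H3) (c : R).

Lemma dotE (p q : 'rV[R]_3) :
  dot p q = p 0 0 * q 0 0 + p 0 1 * q 0 1 + p 0 2%:R * q 0 2%:R.
Proof.
rewrite /dot !big_ord_recl big_ord0 addr0 addrA.
by do ?[congr (_ + _)]; congr (p 0 _ * q 0 _); apply: val_inj.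
Qed.

Lemma dot_vec3 (x y z x' y' z' : R) :
  dot (vec3 x y z) (vec3 x' y' z') = x * x' + y * y' + z * z'.
Proof. by rewrite dotE !mxE. Qed.

(** The Lorentz form for which the Klein ball is the projectivized negative cone:
    a point p of the ball stands for the ray of (p, 1). *)
Definition lor u v : R := dot u.1 v.1 - k * u.2 * v.2.

Lemma lorC u v : lor u v = lor v u.
Proof. by rewrite /lor !dotE; ring. Qed.

Lemma lorDl u v w : lor (u + v) w = lor u w + lor v w.
Proof. by rewrite /lor !dotE /= !mxE; ring. Qed.

Lemma lorZl c u v : lor (c *: u) v = c * lor u v.
Proof. by rewrite /lor !dotE /= !mxE /GRing.scale /=; ring. Qed.

Lemma lorDr u v w : lor w (u + v) = lor w u + lor w v.
Proof. by rewrite !(lorC w) lorDl. Qed.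

Lemma lorZr c u v : lor u (c *: v) = c * lor u v.
Proof. by rewrite !(lorC u) lorZl. Qed.

Lemma lorNl u v : lor (- u) v = - lor u v.
Proof. by rewrite -scaleN1r lorZl mulN1r. Qed.

Lemma lorNr u v : lor u (- v) = - lor u v.
Proof. by rewrite !(lorC u) lorNl. Qed.

Definition lorE := (lorDl, lorDr, lorZl, lorZr, lorNl, lorNr).

Lemma k_gt0 : 0 < k.
Proof. by rewrite klein_radius_sqr; have := tau_gt0 R; lra. Qed.

Definition future u : Prop := lor u u < 0 /\ 0 < u.2.

Lemma dot_cauchy (p q : 'rV[R]_3) : dot p q ^+ 2 <= dot p p * dot q q.
Proof.
rewrite -subr_ge0 !dotE.
move: (p 0 0) (p 0 1) (p 0 2%:R) (q 0 0) (q 0 1) (q 0 2%:R) => a b c a' b' c'.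
rewrite [X in 0 <= X](_ : _ = (a * b' - b * a') ^+ 2 + (a * c' - c * a') ^+ 2
  + (b * c' - c * b') ^+ 2); last by ring.
by rewrite !addr_ge0 // sqr_ge0.
Qed.

Lemma dot_ge0 (p : 'rV[R]_3) : 0 <= dot p p.
Proof. by rewrite dotE -!expr2 !addr_ge0 // sqr_ge0. Qed.

Lemma dot_eq0 (p : 'rV[R]_3) : dot p p <= 0 -> p = 0.
Proof.
rewrite dotE => p0; apply/rowP => i; rewrite mxE.
have h (a : R) : a * a <= 0 -> a = 0 by move=> ?; nra.
have [h0 h1 h2] : [/\ p 0 0 = 0, p 0 1 = 0 & p 0 2%:R = 0].
  by split; apply: h; nra.
case: i => [[|[|[|//]]] i3]; [rewrite -h0|rewrite -h1|rewrite -h2];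
  by congr (p 0 _); apply: val_inj.
Qed.

(** Reverse Cauchy-Schwarz inequality. It bounds the argument of arcosh in the
    distance below by 1, so that the distance determines the form. *)
Lemma lor_reverse_cauchy u v : future u -> future v ->
  lor u v < 0 /\ lor u u * lor v v <= lor u v ^+ 2.
Proof.
rewrite /future /lor; case: u v => [p a] [q b] /=.
move: (dot_cauchy p q) (dot_ge0 p) (dot_ge0 q) k_gt0.
move: (dot p q) (dot p p) (dot q q) k => s P Q K sPQ P0 Q0 K0 [Pa a0] [Qb b0].
have [g [g0 gg]] : exists g : R, 0 <= g /\ g ^+ 2 = P * Q.
  by exists (Num.sqrt (P * Q)); rewrite sqrtr_ge0 sqr_sqrtr // mulr_ge0.
have sg : s <= g.
  by have := @ler_sqr R `|s| g; rewrite !nnegrE real_normK ?num_real //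
    normr_ge0 g0 gg sPQ => /(_ isT isT) /esym sg; apply: le_trans (ler_norm s) _.
have gKab : g < K * a * b.
  rewrite -ltr_sqr ?nnegrE // ?mulr_ge0 // ?(ltW K0, ltW a0, ltW b0) // gg.
  have ->: (K * a * b) ^+ 2 = (K * a * a) * (K * b * b) by ring.
  by apply: ltr_pM => //; rewrite ?subr_lt0 // in Pa Qb *.
split; first by lra.
have amgm : 2 * a * b * g <= P * b ^+ 2 + Q * a ^+ 2.
  have [r [r0 rr]] : exists r : R, 0 <= r /\ r ^+ 2 = P.
    by exists (Num.sqrt P); rewrite sqrtr_ge0 sqr_sqrtr.
  have [t [t0 tt]] : exists t : R, 0 <= t /\ t ^+ 2 = Q.
    by exists (Num.sqrt Q); rewrite sqrtr_ge0 sqr_sqrtr.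
  have -> : g = r * t.
    apply/eqP; rewrite -(@eqrXn2 _ 2) // ?mulr_ge0 // gg exprMn rr tt //.
  have := sqr_ge0 (r * b - t * a); rewrite -rr -tt; nra.
have : (K * a * b - g) ^+ 2 <= (s - K * a * b) ^+ 2.
  have : 0 <= K * a * b - g by lra.
  have : K * a * b - g <= K * a * b - s by lra.
  nra.
apply: le_trans; rewrite -subr_ge0.
have -> : (K * a * b - g) ^+ 2 - (P - K * a * a) * (Q - K * b * b)
  = g ^+ 2 - P * Q + K * (P * b ^+ 2 + Q * a ^+ 2 - 2 * a * b * g) by ring.
by rewrite gg subrr add0r mulr_ge0 ?(ltW K0) // subr_ge0.
Qed.

Definition hpt x : V := (val x, 1).

Lemma future_hpt x : future (hpt x).
Proof. by split=> //; rewrite /lor /= !mulr1 subr_lt0; exact: (valP x). Qed.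

Lemma hpt_inj c x y : hpt x = c *: hpt y -> x = y.
Proof.
move=> [E1 E2]; apply: val_inj; rewrite /= E1.
have <- : 1 = c by move: E2; rewrite /GRing.scale /= mulr1.
by rewrite scale1r.
Qed.

Lemma futureP u : future u -> exists x c, 0 < c /\ u = c *: hpt x.
Proof.
case: u => p a [/= pa a0].
have ball : dot (a^-1 *: p) (a^-1 *: p) < k.
  have -> : dot (a^-1 *: p) (a^-1 *: p) = dot p p / a ^+ 2.
    by rewrite !dotE !mxE; field; rewrite gt_eqF.
  rewrite ltr_pdivrMr ?exprn_gt0 //.
  by move: pa; rewrite /lor /= subr_lt0 -mulrA -expr2.
exists (exist (fun r : 'rV[R]_3 => is_true (dot r r < k)) _ ball), a; split=> //; congr pair => /=.
  by rewrite scalerA mulfV ?gt_eqF // scale1r.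
by rewrite /GRing.scale /= mulr1.
Qed.

(** The point of the hyperboloid lor u u = -1 above x. It is locked so that
    rewriting with bilinearity does not see the scalar factor. *)
Definition hyp x : V :=
  locked ((Num.sqrt (- lor (hpt x) (hpt x)))^-1 *: hpt x).

Lemma hypE x : hyp x = (Num.sqrt (- lor (hpt x) (hpt x)))^-1 *: hpt x.
Proof. by rewrite /hyp -lock. Qed.

Lemma hyp_scale_gt0 x : 0 < (Num.sqrt (- lor (hpt x) (hpt x)))^-1.
Proof. by rewrite invr_gt0 sqrtr_gt0 oppr_gt0; case: (future_hpt x). Qed.

Lemma lor_hyp x : lor (hyp x) (hyp x) = -1.
Proof.
have [x0 _] := future_hpt x; rewrite hypE !lorE mulrA -invfM -expr2.
by rewrite sqr_sqrtr ?oppr_ge0 ?ltW // invrN mulNr mulVf // lt_eqF.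
Qed.

Lemma futureZ c u : 0 < c -> future u -> future (c *: u).
Proof.
move=> c0 [u0 u2]; split; last by rewrite /GRing.scale /= mulr_gt0.
by rewrite !lorE !pmulr_rlt0.
Qed.

Lemma future_hyp x : future (hyp x).
Proof. by rewrite hypE; apply: futureZ (future_hpt x); apply: hyp_scale_gt0. Qed.

Lemma hyp_inj x y : hyp x = hyp y -> x = y.
Proof.
move=> /(congr1 (fun v => Num.sqrt (- lor (hpt x) (hpt x)) *: v)).
have := hyp_scale_gt0 x; rewrite invr_gt0 => x0.
by rewrite !hypE !scalerA mulfV ?gt_eqF // scale1r; apply: hpt_inj.
Qed.

Lemma hypP u : future u -> lor u u = -1 -> exists x, u = hyp x.
Proof.
move=> /futureP[x [c [c0 uE]]] u1; exists x; rewrite hypE.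
rewrite uE; congr (_ *: _); have s0 := hyp_scale_gt0 x.
move: u1 s0; rewrite uE !lorE; move: (lor _ _) => l cl s0.
have l0 : l = - c^-1 ^+ 2 by field: cl; rewrite gt_eqF.
by rewrite l0 opprK sqrtr_sqr gtr0_norm ?invrK // invr_gt0.
Qed.

Lemma hdistE x y : hdist x y = arcosh (- lor (hyp x) (hyp y)).
Proof.
rewrite /hdist; congr arcosh; rewrite !hypE !lorE.
have [x0 _] := future_hpt x; have [y0 _] := future_hpt y.
rewrite sqrtrM; last by rewrite subr_ge0 ltW //; exact: (valP x).
have E (z w : H3) : k - dot (\val z) (\val w) = - lor (hpt z) (hpt w).
  by rewrite /lor /= !mulr1 opprB.
by rewrite !E invfM; ring.
Qed.

(** For s at least 1 the number s + sqrt (s^2 - 1) has inverse s - sqrt (s^2 - 1),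
    so s is half the sum of it and its inverse. *)
Lemma arcosh_inj (s t : R) : 1 <= s -> 1 <= t -> arcosh s = arcosh t -> s = t.
Proof.
have pos (z : R) : 1 <= z -> 0 < z + Num.sqrt (z ^+ 2 - 1).
  by move=> z1; have := sqrtr_ge0 (z ^+ 2 - 1); lra.
have inv (z : R) : 1 <= z -> z = (z + Num.sqrt (z ^+ 2 - 1)
    + (z + Num.sqrt (z ^+ 2 - 1))^-1) / 2.
  move=> z1; have z0 := pos z z1.
  have /sqr_sqrtr : 0 <= z ^+ 2 - 1 by nra.
  move: z0; move: (Num.sqrt _) => r r0 rr.
  have -> : (z + r)^-1 = z - r.
    apply: (mulfI (lt0r_neq0 r0)); rewrite mulfV ?gt_eqF //.
    by have := rr; rewrite !expr2 => ?; nra.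
  by field.
move=> s1 t1 /ln_inj st; rewrite (inv s s1) (inv t t1).
by rewrite st ?posrE ?pos.
Qed.

Lemma hyp_ge1 x y : 1 <= - lor (hyp x) (hyp y).
Proof.
have [] := lor_reverse_cauchy (future_hyp x) (future_hyp y).
by rewrite !lor_hyp; move: (lor _ _) => l; nra.
Qed.

(** On the hyperboloid the form is minus the hyperbolic cosine of the distance, so
    abstract isometries of the ball become maps preserving the form. *)
Lemma hisometric_lor (g : hisometry R) x y :
  lor (hyp (g x)) (hyp (g y)) = lor (hyp x) (hyp y).
Proof.
have [_ /(_ x y)] := hisometryP g; rewrite !hdistE => /arcosh_inj.
by rewrite !hyp_ge1 => /(_ isT isT) /oppr_inj.
Qed.

Lemma lor_nondegenerate u : (forall v, lor u v = 0) -> u = 0.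
Proof.
case: u => p a /(_ (p, - a)); rewrite /lor /= mulrN opprK => u0.
have := dot_ge0 p; have K0 := k_gt0.
have ka : 0 <= k * a * a by rewrite -mulrA mulr_ge0 ?(ltW K0) // -expr2 sqr_ge0.
move=> p0; have p_eq0 : dot p p <= 0 by lra.
congr pair; first exact: dot_eq0.
have /eqP : a * a = 0.
  by apply: (mulfI (lt0r_neq0 K0)); rewrite mulr0 mulrA; lra.
by rewrite mulf_eq0 orbb => /eqP.
Qed.

Lemma lor_inj u v : (forall w, lor u w = lor v w) -> u = v.
Proof.
move=> uv; apply/eqP; rewrite -subr_eq0; apply/eqP.
by apply: lor_nondegenerate => w; rewrite !lorE uv subrr.
Qed.

(** For e, f orthonormal: the quarter turn of their plane that takes e to f,
    extended by the identity on the orthogonal complement. *)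
Definition rot90 (e f v : V) : V :=
  v - lor v e *: e - lor v f *: f + lor v e *: f - lor v f *: e.

(** A line of the ball given by the orthogonal complement of its span. All rotations
    about it act on the plane of e and f, whence this description. *)
Definition polar_line (e f : V) : set H3 :=
  [set x | lor (hpt x) e = 0 /\ lor (hpt x) f = 0].

Definition orthonormal_pair (e f : V) : Prop :=
  [/\ lor e e = 1, lor f f = 1 & lor e f = 0].

Lemma orthonormal_pairC e f : orthonormal_pair e f -> orthonormal_pair f e.
Proof. by case=> ee ff ef; split=> //; rewrite lorC. Qed.

Lemma polar_lineC e f : polar_line e f = polar_line f e.
Proof. by apply/seteqP; split=> x []. Qed.

Lemma polar_line_hyp e f x :
  polar_line e f x <-> lor (hyp x) e = 0 /\ lor (hyp x) f = 0.
Proof.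
have s0 := lt0r_neq0 (hyp_scale_gt0 x); rewrite /polar_line /= hypE !lorZl.
split=> [[-> ->]|[/eqP + /eqP]]; first by rewrite !mulr0.
by rewrite !mulf_eq0 (negPf s0) /= => /eqP -> /eqP ->.
Qed.

Lemma rot90Z e f c u : rot90 e f (c *: u) = c *: rot90 e f u.
Proof. by apply: lor_inj => w; rewrite /rot90 !lorE; ring. Qed.

Lemma rot90D e f u v : rot90 e f (u + v) = rot90 e f u + rot90 e f v.
Proof. by apply: lor_inj => w; rewrite /rot90 !lorE; ring. Qed.

Lemma rot90K e f : orthonormal_pair e f -> cancel (rot90 e f) (rot90 f e).
Proof.
move=> [ee ff ef] u; apply: lor_inj => w.
by rewrite /rot90 !lorE (lorC f e) ee ff ef; ring.
Qed.

Lemma lor_rot90 e f u v : lor (rot90 e f u) v = lor u (rot90 f e v).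
Proof. by rewrite /rot90 !lorE (lorC e v) (lorC f v); ring. Qed.

Lemma rot90_isometry e f u v : orthonormal_pair e f ->
  lor (rot90 e f u) (rot90 e f v) = lor u v.
Proof. by move=> ef; rewrite lor_rot90 rot90K. Qed.

Lemma rot90_polar_line e f x : polar_line e f x -> rot90 e f (hpt x) = hpt x.
Proof. by case=> xe xf; rewrite /rot90 xe xf !scale0r !(subr0, addr0). Qed.

(** The points of the line span the complement of e and f: a vector w of the
    complement added to a large multiple of a point o of the line is still future,
    so it lies above a point of the line. A vector orthogonal to the line is then
    orthogonal to that whole complement. *)
Lemma polar_line_perp e f o u : orthonormal_pair e f -> polar_line e f o ->
  (forall x, polar_line e f x -> lor u (hpt x) = 0) ->
  u = lor u e *: e + lor u f *: f.
Proof.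
move=> [ee ff ef] oL uL.
have uP w : lor w e = 0 -> lor w f = 0 -> lor u w = 0.
  move=> we wf; have [oe of_] := oL; have [oo o2] := future_hpt o.
  pose m := lor (hpt o) w.
  pose c := 1 + `|w.2| + (2 * `|m| + `|lor w w|) / - lor (hpt o) (hpt o).
  have q0 : 0 <= (2 * `|m| + `|lor w w|) / - lor (hpt o) (hpt o).
    apply: divr_ge0; last by rewrite oppr_ge0 ltW.
    by apply: addr_ge0 => //; apply: mulr_ge0.
  have c1 : 1 <= c by have := normr_ge0 w.2; rewrite /c; lra.
  have cl : c * lor (hpt o) (hpt o) + (2 * `|m| + `|lor w w|) < 0.
    rewrite /c; move: q0; set q := _ / _ => q0.
    have qE : q * lor (hpt o) (hpt o) = - (2 * `|m| + `|lor w w|).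
      by rewrite /q; field; rewrite lt_eqF.
    have := normr_ge0 w.2; nra.
  have vfut : future (c *: hpt o + w).
    split.
      rewrite !lorE (lorC w) -/m.
      have : m <= `|m| by apply: ler_norm.
      have : lor w w <= `|lor w w| by apply: ler_norm.
      have : 0 <= `|lor w w| by [].
      nra.
    rewrite /= /GRing.scale /= mulr1.
    have : - w.2 <= `|w.2| by rewrite -normrN ler_norm.
    by rewrite /c; lra.
  have [x [d [d0 vE]]] := futureP vfut.
  have xL : polar_line e f x.
    have /eqP : d * lor (hpt x) e = 0 by rewrite -lorZl -vE !lorE oe we; ring.
    have /eqP : d * lor (hpt x) f = 0 by rewrite -lorZl -vE !lorE of_ wf; ring.
    by rewrite !mulf_eq0 !(gt_eqF d0) /= => /eqP ? /eqP.
  have : lor u (c *: hpt o + w) = 0 by rewrite vE lorZr uL // mulr0.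
  by rewrite lorDr lorZr uL // mulr0 add0r.
apply: lor_inj => v.
have := uP (v - lor v e *: e - lor v f *: f).
rewrite !lorE (lorC f e) ee ff ef.
rewrite (lorC e v) (lorC f v) => uv.
have {}uv : lor u v - lor v e * lor u e - lor v f * lor u f = 0.
  by apply: uv; ring.
by lra.
Qed.

(** The Riemannian metric at p is the Lorentz form on the complement of hyp p. The
    segments from p to x and y are orthogonal exactly when the projections of
    hyp x and hyp y to that complement are. *)
Lemma klein_metric_eq0 p x y :
  klein_metric (\val p) (\val x - \val p) (\val y - \val p) = 0 <->
  lor (hyp p) (hyp x) * lor (hyp p) (hyp y) + lor (hyp x) (hyp y) = 0.
Proof.
have [p0 _] := future_hpt p.
have -> : klein_metric (\val p) (\val x - \val p) (\val y - \val p) =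
    (lor (hpt p) (hpt x) * lor (hpt p) (hpt y)
     - lor (hpt p) (hpt p) * lor (hpt x) (hpt y)) / lor (hpt p) (hpt p) ^+ 2.
  have dotB (r u v : 'rV[R]_3) : dot (u - r) (v - r) =
      dot u v - dot r u - dot r v + dot r r by rewrite !dotE !mxE; ring.
  have dotBr (r u : 'rV[R]_3) : dot r (u - r) = dot r u - dot r r.
    by rewrite !dotE !mxE; ring.
  move: p0; rewrite /klein_metric /lor /= !mulr1 dotB !dotBr.
  by move: (dot _ _) (dot _ _) (dot _ _) (dot _ _) => a b c d p0; field; lra.
have E : lor (hyp p) (hyp x) * lor (hyp p) (hyp y) + lor (hyp x) (hyp y) =
    (lor (hpt p) (hpt x) * lor (hpt p) (hpt y)
     - lor (hpt p) (hpt p) * lor (hpt x) (hpt y)) *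
    ((Num.sqrt (- lor (hpt x) (hpt x)))^-1 * (Num.sqrt (- lor (hpt y) (hpt y)))^-1
     * (- lor (hpt p) (hpt p))^-1).
  have sp : (Num.sqrt (- lor (hpt p) (hpt p)))^-1 ^+ 2 = (- lor (hpt p) (hpt p))^-1.
    by rewrite exprVn sqr_sqrtr // oppr_ge0 ltW.
  rewrite !hypE !lorE; move: sp p0.
  set a := (Num.sqrt (- lor (hpt p) (hpt p)))^-1 => aE p0.
  set b := (Num.sqrt (- lor (hpt x) (hpt x)))^-1.
  set c := (Num.sqrt (- lor (hpt y) (hpt y)))^-1.
  transitivity (a ^+ 2 * (b * c * (lor (hpt p) (hpt x) * lor (hpt p) (hpt y)))
    + b * c * lor (hpt x) (hpt y)); first by ring.
  by rewrite aE; field; rewrite lt_eqF.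
have xy0 := mulf_neq0 (lt0r_neq0 (hyp_scale_gt0 x)) (lt0r_neq0 (hyp_scale_gt0 y)).
have pp0 : (- lor (hpt p) (hpt p))^-1 != 0 by rewrite invr_eq0 oppr_eq0 lt_eqF.
have pp2 : (lor (hpt p) (hpt p) ^+ 2)^-1 != 0.
  by rewrite invr_eq0 expf_neq0 // lt_eqF.
rewrite E; split=> /eqP; rewrite mulf_eq0 => /orP[/eqP ->|]; rewrite ?mul0r //.
  by move=> /eqP pp2'; rewrite pp2' eqxx in pp2.
by rewrite mulf_eq0 (negPf xy0) (negPf pp0).
Qed.

Lemma lor_hypr u x :
  lor u (hyp x) = (Num.sqrt (- lor (hpt x) (hpt x)))^-1 * lor u (hpt x).
Proof. by rewrite hypE lorZr. Qed.

(** Since g fixes the line pointwise and keeps the form, hyp (g x) - hyp x is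
    orthogonal to the line, so only the coordinates of hyp x along e and f change,
    and they change by a map keeping inner products. For a point x whose
    foot on the line is o the hypothesis on g says that the vector of these
    coordinates is turned by a right angle. There are such x in every direction,
    and planar_quarter_turn concludes. *)
Lemma rotation90_aboutP e f o (g : hisometry R) :
  orthonormal_pair e f -> polar_line e f o ->
  rotation90_about (polar_line e f) g ->
  (forall x, hyp (g x) = rot90 e f (hyp x)) \/
  (forall x, hyp (g x) = rot90 f e (hyp x)).
Proof.
move=> ef oL [gfix grot]; have [ee ff e_f] := ef.
have [oe of_] := (polar_line_hyp e f o).1 oL.
pose A x := lor (hyp x) e; pose B x := lor (hyp x) f.
have gfixl x p : polar_line e f p -> lor (hyp (g x)) (hyp p) = lor (hyp x) (hyp p).
  by move=> pL; rewrite -(hisometric_lor g x p) (gfix p pL).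
have gE x : hyp (g x) = hyp x + (A (g x) - A x) *: e + (B (g x) - B x) *: f.
  have /(polar_line_perp ef oL) :
      forall p, polar_line e f p -> lor (hyp (g x) - hyp x) (hpt p) = 0.
    move=> p pL; have := gfixl x p pL; rewrite !lor_hypr.
    move/(mulfI (lt0r_neq0 (hyp_scale_gt0 p))) => E.
    by rewrite lorDl lorNl E subrr.
  rewrite !lorE -/(A _) -/(A _) -/(B _) -/(B _) => /eqP.
  by rewrite subr_eq addrC addrA => /eqP.
have AB x y : A (g x) * A (g y) + B (g x) * B (g y) = A x * A y + B x * B y.
  have := hisometric_lor g x y; rewrite (gE y) !lorE -/(A (g x)) -/(B (g x)).
  rewrite (gE x) !lorE (lorC e) (lorC f) -/(A y) -/(B y); lra.
(* points with foot o, in the direction a e + b f *)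
have special a b : a != 0 \/ b != 0 -> exists s x, [/\ 0 < s, A x = s * a, B x = s * b
    & A (g x) * A x + B (g x) * B x = 0].
  move=> ab0.
  have [oo o2] := future_hyp o.
  pose c := 1 + `|a| + `|b| + (`|a * e.2| + `|b * f.2|) / (hyp o).2.
  have q0 : 0 <= (`|a * e.2| + `|b * f.2|) / (hyp o).2.
    by apply: divr_ge0; [apply: addr_ge0|apply: ltW].
  have cab : 1 + `|a| + `|b| <= c by rewrite /c; lra.
  have co2 : `|a * e.2| + `|b * f.2| < c * (hyp o).2.
    have -> : c * (hyp o).2 = (1 + `|a| + `|b|) * (hyp o).2
        + (`|a * e.2| + `|b * f.2|) by rewrite /c; field; rewrite gt_eqF.
    by rewrite ltrDr mulr_gt0 // ltr_pwDl // addr_ge0.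
  have wfut : future (c *: hyp o + (a *: e + b *: f)).
    split.
      rewrite !lorE (lorC e (hyp o)) (lorC f (hyp o)) (lorC f e) oe of_ ee ff e_f lor_hyp.
      have aa : a * a = `|a| * `|a| by rewrite -normrM ger0_norm // -expr2 sqr_ge0.
      have bb : b * b = `|b| * `|b| by rewrite -normrM ger0_norm // -expr2 sqr_ge0.
      have := normr_ge0 a; have := normr_ge0 b; nra.
    rewrite /= /GRing.scale /=.
    have : - (a * e.2) <= `|a * e.2| by rewrite -normrN ler_norm.
    have : - (b * f.2) <= `|b * f.2| by rewrite -normrN ler_norm.
    by lra.
  have [x [d [d0 wE]]] := futureP wfut.
  have [s [s0 xE]] : exists s, 0 < s /\
      hyp x = s *: (c *: hyp o + (a *: e + b *: f)).
    exists ((Num.sqrt (- lor (hpt x) (hpt x)))^-1 / d).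
    by rewrite divr_gt0 ?hyp_scale_gt0 // wE scalerA divfK ?gt_eqF // hypE.
  have Ax : A x = s * a.
    by rewrite /A xE !lorE (lorC f e) oe ee e_f; ring.
  have Bx : B x = s * b by rewrite /B xE !lorE of_ ff e_f; ring.
  exists s, x; split=> //.
  have lox q : polar_line e f q -> lor (hyp q) (hyp x) = s * c * lor (hyp q) (hyp o).
    by move=> /polar_line_hyp[qe qf]; rewrite xE !lorE qe qf; ring.
  have xL : ~ polar_line e f x.
    move=> /polar_line_hyp[]; rewrite -/(A x) -/(B x) Ax Bx => /eqP + /eqP.
    by rewrite !mulf_eq0 !(gt_eqF s0) /= => a0 b0; case: ab0; rewrite ?a0 ?b0.
  have xperp : perpendicular_at (polar_line e f) o x.
    move=> q qL; apply/klein_metric_eq0; rewrite !lox // lor_hyp.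
    by rewrite (lorC (hyp o) (hyp q)); ring.
  have /klein_metric_eq0 := grot o x oL xL xperp.
  rewrite ![lor (hyp o) _]lorC gfixl // (lorC _ (hyp o)) lox // lor_hyp.
  rewrite (gE x) !lorE -/(A x) -/(B x).
  have : lor (hyp x) (hyp x) = - (s * c) ^+ 2 + A x ^+ 2 + B x ^+ 2.
    rewrite Ax Bx xE !lorE (lorC e (hyp o)) (lorC f (hyp o)) (lorC f e) oe of_ ee ff e_f.
    by rewrite lor_hyp; ring.
  lra.
have [s1 [x1 [s1_0 A1 B1 g1]]] : _ := special 1 0 (or_introl (oner_neq0 _)).
have [s2 [x2 [s2_0 A2 B2 g2]]] : _ := special 1 1 (or_introl (oner_neq0 _)).
have [s3 [x3 [s3_0 A3 B3 g3]]] : _ := special 0 1 (or_intror (oner_neq0 _)).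
rewrite ?mulr0 ?mulr1 in A1 B1 A2 B2 A3 B3.
have [turn|turn] := planar_quarter_turn
  (lt0r_neq0 s1_0) (lt0r_neq0 s2_0) (lt0r_neq0 s3_0) A1 B1 A2 B2 A3 B3 AB g1 g2 g3;
  [left|right] => x; have [Ag Bg] := turn x; rewrite gE Ag Bg; apply: lor_inj => w;
  by rewrite /rot90 !lorE -/(A x) -/(B x); ring.
Qed.

End LorentzSpace.

(** * Existence of quarter turns, and their axes *)

Section Rotations.
Variable R : realType.
Local Notation k := (klein_radius R ^+ 2).
Local Notation V := ('rV[R]_3 * R^o)%type.
Local Notation H3 := (H3 R).
Implicit Types (u v w e f : V) (x y o : H3).

(** The turned vector has a negative product with a fixed point of the line, which
    places it on the future half of the cone. *)
Lemma future_rot90 e f o u : orthonormal_pair e f -> polar_line e f o ->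
  future u -> future (rot90 e f u).
Proof.
move=> ef oL fu; have [u0 u2] := fu.
have ru0 : lor (rot90 e f u) (rot90 e f u) < 0 by rewrite rot90_isometry.
have ruo : lor (rot90 e f u) (hpt o) < 0.
  rewrite lor_rot90 // rot90_polar_line; last by rewrite polar_lineC.
  by have [] := lor_reverse_cauchy fu (future_hpt o).
move: (rot90 e f u) ru0 ruo => r r0 ro {fu u u0 u2}.
split=> //; rewrite ltNge; apply/negP => r2.
have fNr : future (- r).
  split; first by rewrite lorNl lorNr opprK.
  rewrite /= oppr_gt0 lt_neqAle r2 andbT; apply/eqP => r2_0.
  by move: r0; rewrite /lor r2_0 !mulr0 subr0; have := dot_ge0 r.1; lra.
by have [] := lor_reverse_cauchy fNr (future_hpt o); rewrite lorNl; lra.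
Qed.

Lemma exists_rotation90 e f o : orthonormal_pair e f -> polar_line e f o ->
  exists g : hisometry R, (forall x, hyp (g x) = rot90 e f (hyp x)) /\
    rotation90_about (polar_line e f) g.
Proof.
move=> ef oL; have fe := orthonormal_pairC ef.
have ext e' f' : orthonormal_pair e' f' -> polar_line e' f' o ->
    exists G : H3 -> H3, forall x, hyp (G x) = rot90 e' f' (hyp x).
  move=> ef' oL'; suff /choice[G GE] : forall x, exists y, hyp y = rot90 e' f' (hyp x).
    by exists G.
  move=> x; have [y yE] : exists y, rot90 e' f' (hyp x) = hyp y; last by exists y.
  apply: hypP; first exact: (future_rot90 ef' oL' (future_hyp x)).
  by rewrite rot90_isometry ?lor_hyp.
have [G GE] := ext e f ef oL.
have [G' G'E] : exists G : H3 -> H3, forall x, hyp (G x) = rot90 f e (hyp x).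
  by apply: ext => //; rewrite polar_lineC.
have Giso : hisometric G.
  split; last by move=> x y; rewrite !hdistE !GE rot90_isometry.
  by exists G' => x; apply: hyp_inj; rewrite !(GE, G'E) rot90K.
exists (HIsometry (asboolT Giso)); split=> //; split=> [x xL|p x pL xL xperp] /=.
  by apply: hyp_inj; rewrite GE hypE rot90Z rot90_polar_line.
apply/klein_metric_eq0; rewrite !GE.
(* the component of hyp x orthogonal to the line *)
have [w wdef] : exists w, w = hyp x + lor (hyp p) (hyp x) *: hyp p by eexists.
have [pe pf] := (polar_line_hyp e f p).1 pL.
have wE : w = lor w e *: e + lor w f *: f.
  apply: (polar_line_perp ef oL) => q qL.
  have /klein_metric_eq0 := xperp q qL.
  apply: contra_eq => wq; have /eqP := wq => {}wq; apply/eqP => qpx.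
  apply: wq; apply: (mulfI (lt0r_neq0 (hyp_scale_gt0 q))).
  rewrite mulr0 -lor_hypr wdef lorDl lorZl -[RHS]qpx.
  by rewrite (lorC (hyp x)) (lorC (hyp p) (hyp q)); ring.
have [m xE] : exists m, hyp x = w - m *: hyp p.
  by exists (lor (hyp p) (hyp x)); rewrite wdef addrK.
have rp : rot90 e f (hyp p) = hyp p by rewrite hypE rot90Z rot90_polar_line.
have ww : lor w w = lor w e ^+ 2 + lor w f ^+ 2.
  by rewrite {1}wE lorDl !lorZl !(lorC _ w).
have wrw : lor w (rot90 e f w) = 0.
  by rewrite /rot90 !(lorDr, lorNr, lorZr) ww; ring.
have wp : lor w (hyp p) = 0.
  by rewrite wE lorDl !lorZl (lorC e) (lorC f) pe pf !mulr0 addr0.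
have prw : lor (hyp p) (rot90 e f w) = 0.
  by rewrite lorC lor_rot90 // -[hyp p in LHS]rp rot90K // wp.
rewrite xE -scaleNr addrC rot90D rot90Z rp.
move: (rot90 e f w) wrw prw => r wr pr.
by rewrite !lorE lor_hyp wr pr (lorC (hyp p) w) wp; ring.
Qed.

Definition cross (p q : 'rV[R]_3) : 'rV[R]_3 := vec3
  (p 0 1 * q 0 2%:R - p 0 2%:R * q 0 1)
  (p 0 2%:R * q 0 0 - p 0 0 * q 0 2%:R)
  (p 0 0 * q 0 1 - p 0 1 * q 0 0).

Lemma row3P (p q : 'rV[R]_3) : p 0 0 = q 0 0 -> p 0 1 = q 0 1 ->
  p 0 2%:R = q 0 2%:R -> p = q.
Proof.
move=> h0 h1 h2; apply/rowP => -[[|[|[|//]]] i3].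
- by rewrite (_ : Ordinal i3 = 0) //; apply: val_inj.
- by rewrite (_ : Ordinal i3 = 1) //; apply: val_inj.
- by rewrite (_ : Ordinal i3 = 2%:R) //; apply: val_inj.
Qed.

Lemma dot_cross (p q : 'rV[R]_3) :
  dot (cross p q) (cross p q) = dot p p * dot q q - dot p q ^+ 2.
Proof. by rewrite dot_vec3 !dotE; ring. Qed.

(** The triple product n * (d * n) with n = p * q vanishes, as d * n is a combination
    of p and q with coefficients dot d q and dot d p. *)
Lemma cross_perp (p q d : 'rV[R]_3) : dot d p = 0 -> dot d q = 0 ->
  dot (cross p q) (cross p q) *: d = dot d (cross p q) *: cross p q.
Proof.
move=> dp dq; have -> : dot (cross p q) (cross p q) *: d =
    dot d (cross p q) *: cross p q
    + cross (cross p q) (dot d q *: p - dot d p *: q).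
  by apply: row3P; rewrite !dotE !mxE /= ?dotE; ring.
rewrite dp dq !scale0r subr0 -[RHS]addr0; congr (_ + _).
by apply: row3P; rewrite !mxE /= !mulr0 subr0.
Qed.

(** The direction is the cross product n of the space parts of e and f. It is nonzero:
    by Lagrange's identity and orthonormality its squared length is
    1 + k * (e.2 ^+ 2 + f.2 ^+ 2). *)
Lemma polar_line_hline e f : orthonormal_pair e f ->
  polar_line e f !=set0 -> is_hline (polar_line e f).
Proof.
move=> [ee ff ef] [x [xe xf]]; split; first by exists x.
pose n := cross e.1 f.1.
have n0 : 0 < dot n n.
  rewrite dot_cross; have K0 := k_gt0.
  have -> : dot e.1 e.1 = 1 + k * e.2 ^+ 2 by move: ee; rewrite /lor; lra.
  have -> : dot f.1 f.1 = 1 + k * f.2 ^+ 2 by move: ff; rewrite /lor; lra.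
  have -> : dot e.1 f.1 = k * e.2 * f.2 by move: ef; rewrite /lor; lra.
  have : 0 <= k * e.2 ^+ 2 by rewrite mulr_ge0 ?(ltW K0) ?sqr_ge0.
  have : 0 <= k * f.2 ^+ 2 by rewrite mulr_ge0 ?(ltW K0) ?sqr_ge0.
  nra.
have dE (y : H3) (g : V) : dot (\val y - \val x) g.1 = lor (hpt y) g - lor (hpt x) g.
  by rewrite /lor /= !dotE !mxE; ring.
exists (\val x), n; split.
  by apply: contraTneq n0 => ->; rewrite dotE !mxE !mulr0 !addr0 ltxx.
apply/seteqP; split=> [y [ye yf]|y [t yE]].
  exists (dot (\val y - \val x) n / dot n n).
  apply/eqP; rewrite addrC -subr_eq; apply/eqP.
  apply: (scalerI (lt0r_neq0 n0)); rewrite scalerA [_ * (_ / _)]mulrC.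
  by rewrite divfK ?gt_eqF //; apply: cross_perp; rewrite dE ?ye ?yf ?xe ?xf subrr.
have tn : \val y - \val x = t *: n by rewrite yE addrC addKr.
have dt g : dot n g = 0 -> dot (t *: n) g = 0.
  by move=> ng; rewrite -(mulr0 t) -ng !dotE !mxE; ring.
split; apply/eqP.
  rewrite -(subr0 (lor _ _)) -[X in _ - X]xe -dE tn dt //.
  by rewrite !dotE !mxE /=; ring.
rewrite -(subr0 (lor _ _)) -[X in _ - X]xf -dE tn dt //.
by rewrite !dotE !mxE /=; ring.
Qed.
End Rotations.

(** * The lattice over the golden integers and its walls *)

Section GoldenLattice.
Local Notation zt := (int * int)%type.
Local Notation lattice := (zt * zt * zt * zt)%type.
Implicit Types (r s : zt) (u v e f : lattice).

(** The pair (r0, r1) stands for the golden integer r0 + r1 * tau. Working with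
    pairs makes both real embeddings, tau and its conjugate 1 - tau, available. *)
Definition gold_mul r s : zt :=
  (r.1 * s.1 + r.2 * s.2, r.1 * s.2 + r.2 * s.1 + r.2 * s.2).

Definition lscale r v : lattice :=
  let: (x, y, z, w) := v in
  (gold_mul r x, gold_mul r y, gold_mul r z, gold_mul r w).

(** The form x^2 + y^2 + z^2 - tau^3 w^2, where tau^3 = 1 + 2 tau is the squared
    radius of the ball. *)
Definition lform u v : zt :=
  let: (x, y, z, w) := u in let: (x', y', z', w') := v in
  gold_mul x x' + gold_mul y y' + gold_mul z z'
  - gold_mul (1, 2) (gold_mul w w').

Definition lrot e f v : lattice :=
  v - lscale (lform v e) e - lscale (lform v f) f
    + lscale (lform v e) f - lscale (lform v f) e.

(** Orthonormal pairs whose polar lines are the three axes. For the first axis,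
    (0, 0, tau; tau^-1) is the normal of the plane z = tau and tau^-1 = tau - 1.
    All entries being golden integers, the quarter turns preserve the lattice. *)
Definition ea : lattice := (0, (1, 0), 0, 0).
Definition fa : lattice := (0, 0, (0, 1), (-1, 1)).
Definition eb : lattice := (0, 0, (1, 0), 0).
Definition fb : lattice := ((0, 1), 0, 0, (-1, 1)).
Definition ec : lattice := ((1, 0), 0, 0, 0).
Definition fc : lattice := (0, (0, 1), 0, (-1, 1)).

Definition mod4 (m c : int) := (m %% 4)%Z == c.

Definition gold_mod2 r s := ((r.1 %% 2)%Z == s.1) && ((r.2 %% 2)%Z == s.2).

(** Besides having norm 2, the walls are characterized by lying modulo 4 in the orbit
    of the vector (1, 0, -1, 0) under signed quarter turns: the turns about the first
    two axes are composed with - 1, so that they reverse the walls, while the third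
    keeps them. Modulo 2 this orbit has the four elements below, which the turns
    permute like the Klein four-group. *)
Definition wall_residue (i : nat) : lattice :=
  match i with
  | 0%N => ((1, 0), (0, 0), (1, 0), (0, 0))
  | 1%N => ((1, 0), (0, 1), (0, 1), (1, 0))
  | 2%N => ((0, 0), (0, 0), (0, 1), (0, 1))
  | _ => ((0, 0), (0, 1), (1, 0), (1, 1))
  end.

Definition wall_mod2 (i : nat) v : bool :=
  let: (x, y, z, w) := v in let: (x', y', z', w') := wall_residue i in
  [&& gold_mod2 x x', gold_mod2 y y', gold_mod2 z z' & gold_mod2 w w'].

(** Each residue modulo 2 lifts to 2^8 vectors modulo 4; these linear congruences cut
    out the 2^5 of them that lie in the orbit. They exclude the opposites of the
    walls, which is what makes the coorientation consistent. *)
Definition wall_mod4 (i : nat) v : bool :=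
  let: ((x0, x1), (y0, y1), (z0, z1), (w0, w1)) := v in
  mod4 (x1 + y0 + z0 + z1) 3 &&
  match i with
  | 0%N => mod4 (y1 + w1) 0 && mod4 (z0 + w0) 3
  | 1%N => mod4 (y0 + z0) 0 && mod4 (x1 + w1) 0
  | 2%N => mod4 (x0 + y0) 0 && mod4 (x0 + y1 + z1 + w0) 1
  | _ => mod4 (x0 + z0) 3 && mod4 (z0 + z1 + w0 + w1) 3
  end.

Definition wall_class (i : nat) v : bool := wall_mod2 i v && wall_mod4 i v.

Ltac split_congruences :=
  match goal with
  | |- is_true (_ && _) -> _ => case/andP; split_congruences
  | |- is_true (_ == _) -> _ => move/eqP; split_congruences
  | |- _ = _ -> _ => let H := fresh in move=> H; split_congruences
  | |- _ => idtac
  end.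

Ltac solve_congruences :=
  match goal with
  | |- is_true (_ && _) => apply/andP; split; solve_congruences
  | |- is_true (_ == _) => apply/eqP; lia
  end.

Lemma lrot_a v : lrot ea fa v =
  let: ((x0, x1), (y0, y1), (z0, z1), (w0, w1)) := v in
  ((x0, x1),
   (w0 + w1 - z1, w0 + 2 * w1 - z0 - z1),
   (y1 - z1 + w0 + 2 * w1, y0 + y1 - z0 - z1 + 2 * w0 + 3 * w1),
   (y1 - y0 - z0 + w0 + w1, y0 - z1 + w0 + 2 * w1)).
Proof.
move: v => [[[[x0 x1] [y0 y1]] [z0 z1]] [w0 w1]].
by do !congr pair => /=; ring.
Qed.

Lemma lrot_b v : lrot eb fb v =
  let: ((x0, x1), (y0, y1), (z0, z1), (w0, w1)) := v in
  ((z1 - x1 + w0 + 2 * w1, z0 + z1 - x0 - x1 + 2 * w0 + 3 * w1),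
   (y0, y1),
   (w0 + w1 - x1, w0 + 2 * w1 - x0 - x1),
   (z1 - z0 - x0 + w0 + w1, z0 - x1 + w0 + 2 * w1)).
Proof.
move: v => [[[[x0 x1] [y0 y1]] [z0 z1]] [w0 w1]].
by do !congr pair => /=; ring.
Qed.

Lemma lrot_c v : lrot ec fc v =
  let: ((x0, x1), (y0, y1), (z0, z1), (w0, w1)) := v in
  ((w0 + w1 - y1, w0 + 2 * w1 - y0 - y1),
   (x1 - y1 + w0 + 2 * w1, x0 + x1 - y0 - y1 + 2 * w0 + 3 * w1),
   (z0, z1),
   (x1 - x0 - y0 + w0 + w1, x0 - y1 + w0 + 2 * w1)).
Proof.
move: v => [[[[x0 x1] [y0 y1]] [z0 z1]] [w0 w1]].
by do !congr pair => /=; ring.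
Qed.

(** The turn about the first axis reverses the walls and exchanges the classes in
    two pairs; the other two axes give the other two pairings. *)
Lemma wall_class_a v :
  [/\ wall_class 0 v -> wall_class 1 (- lrot ea fa v),
      wall_class 1 v -> wall_class 0 (- lrot ea fa v),
      wall_class 2 v -> wall_class 3 (- lrot ea fa v) &
      wall_class 3 v -> wall_class 2 (- lrot ea fa v)].
Proof.
move: v => [[[[x0 x1] [y0 y1]] [z0 z1]] [w0 w1]].
rewrite lrot_a /wall_class /wall_mod2 /wall_mod4 /gold_mod2 /mod4 /=.
by split; split_congruences; solve_congruences.
Qed.

Lemma wall_class_b v :
  [/\ wall_class 0 v -> wall_class 2 (- lrot eb fb v),
      wall_class 1 v -> wall_class 3 (- lrot eb fb v),
      wall_class 2 v -> wall_class 0 (- lrot eb fb v) &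
      wall_class 3 v -> wall_class 1 (- lrot eb fb v)].
Proof.
move: v => [[[[x0 x1] [y0 y1]] [z0 z1]] [w0 w1]].
rewrite lrot_b /wall_class /wall_mod2 /wall_mod4 /gold_mod2 /mod4 /=.
by split; split_congruences; solve_congruences.
Qed.

Lemma wall_class_c v :
  [/\ wall_class 0 v -> wall_class 3 (lrot ec fc v),
      wall_class 1 v -> wall_class 2 (lrot ec fc v),
      wall_class 2 v -> wall_class 1 (lrot ec fc v) &
      wall_class 3 v -> wall_class 0 (lrot ec fc v)].
Proof.
move: v => [[[[x0 x1] [y0 y1]] [z0 z1]] [w0 w1]].
rewrite lrot_c /wall_class /wall_mod2 /wall_mod4 /gold_mod2 /mod4 /=.
by split; split_congruences; solve_congruences.
Qed.

Definition wall v : bool :=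
  (lform v v == (2, 0)) &&
  [|| wall_class 0 v, wall_class 1 v, wall_class 2 v | wall_class 3 v].

Lemma lformN v : lform (- v) (- v) = lform v v.
Proof.
by move: v => [[[[x0 x1] [y0 y1]] [z0 z1]] [w0 w1]]; congr pair => /=; ring.
Qed.

Lemma lform_lrot_a v : lform (lrot ea fa v) (lrot ea fa v) = lform v v.
Proof.
move: v => [[[[x0 x1] [y0 y1]] [z0 z1]] [w0 w1]]; rewrite lrot_a.
by congr pair => /=; ring.
Qed.

Lemma lform_lrot_b v : lform (lrot eb fb v) (lrot eb fb v) = lform v v.
Proof.
move: v => [[[[x0 x1] [y0 y1]] [z0 z1]] [w0 w1]]; rewrite lrot_b.
by congr pair => /=; ring.
Qed.

Lemma lform_lrot_c v : lform (lrot ec fc v) (lrot ec fc v) = lform v v.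
Proof.
move: v => [[[[x0 x1] [y0 y1]] [z0 z1]] [w0 w1]]; rewrite lrot_c.
by congr pair => /=; ring.
Qed.

Lemma wall_a v : wall v -> wall (- lrot ea fa v).
Proof.
have [c0 c1 c2 c3] := wall_class_a v.
rewrite /wall lformN lform_lrot_a => /andP[-> /or4P[/c0|/c1|/c2|]].
- by move=> ->; rewrite orbT.
- by move=> ->.
- by move=> ->; rewrite !orbT.
- by move=> /c3 ->; rewrite !orbT.
Qed.

Lemma wall_b v : wall v -> wall (- lrot eb fb v).
Proof.
have [c0 c1 c2 c3] := wall_class_b v.
rewrite /wall lformN lform_lrot_b => /andP[-> /or4P[/c0|/c1|/c2|]].
- by move=> ->; rewrite !orbT.
- by move=> ->; rewrite !orbT.
- by move=> ->.
- by move=> /c3 ->; rewrite !orbT.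
Qed.

Lemma wall_c v : wall v -> wall (lrot ec fc v).
Proof.
have [c0 c1 c2 c3] := wall_class_c v.
rewrite /wall lform_lrot_c => /andP[-> /or4P[/c0|/c1|/c2|]].
- by move=> ->; rewrite !orbT.
- by move=> ->; rewrite !orbT.
- by move=> ->; rewrite orbT.
- by move=> /c3 ->.
Qed.

Lemma lrot_a4 v :
  - lrot ea fa (- lrot ea fa (- lrot ea fa (- lrot ea fa v))) = v.
Proof.
rewrite !lrot_a; move: v => [[[[x0 x1] [y0 y1]] [z0 z1]] [w0 w1]].
by do !congr pair => /=; ring.
Qed.

Lemma lrot_b4 v :
  - lrot eb fb (- lrot eb fb (- lrot eb fb (- lrot eb fb v))) = v.
Proof.
rewrite !lrot_b; move: v => [[[[x0 x1] [y0 y1]] [z0 z1]] [w0 w1]].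
by do !congr pair => /=; ring.
Qed.

Lemma lrot_c4 v :
  lrot ec fc (lrot ec fc (lrot ec fc (lrot ec fc v))) = v.
Proof.
rewrite !lrot_c; move: v => [[[[x0 x1] [y0 y1]] [z0 z1]] [w0 w1]].
by do !congr pair => /=; ring.
Qed.

Definition gold_box : seq zt :=
  [seq (i%:Z - 2, j%:Z - 1) | i <- iota 0 5, j <- iota 0 3].

(** The sum of the squares of the two real embeddings. *)
Definition gold_norm r : int := 2 * r.1 * r.1 + 2 * r.1 * r.2 + 3 * r.2 * r.2.

Lemma gold_boxP r : gold_norm r <= 9 -> r \in gold_box.
Proof.
rewrite /gold_norm; case: r => a b /= ab.
have sq : 0 <= (2 * a + b) * (2 * a + b) by rewrite -expr2 sqr_ge0.
have b1 : -1 <= b <= 1 by nia.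
have a2 : -2 <= a <= 2.
  by have [|[|]] : b = -1 \/ b = 0 \/ b = 1 by [lia]; move=> bE; subst b; nia.
by apply/allpairsP; exists (`|(a + 2)%R|%N, `|(b + 1)%R|%N); rewrite !mem_iota /=;
  split; [lia|lia|congr pair; lia].
Qed.

(** A test that implies positivity of the real number r, by the bounds
    8/5 < tau < 34/21. *)
Definition gold_pos r : bool :=
  (0 < 5 * r.1 + 8 * r.2) && (0 < 21 * r.1 + 34 * r.2).

(** Up to the positive factor tau, the values at the points (0, 0, tau) and
    (tau, 0, 0) of the linear function defining the wall v; gold_mul (1, 1) is
    the multiplication by tau^2. *)
Definition side_a v : zt :=
  let: (x, y, z, w) := v in z - gold_mul (1, 1) w.

Definition side_b v : zt :=
  let: (x, y, z, w) := v in x - gold_mul (1, 1) w.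

(** A finite computation: among the walls with coordinates in the box, none has the
    point of the first axis on its positive side or on it and the point of the
    second axis on its negative side or on it. The walls which separate the two
    points are x = z and z = 1, both with the second point on the positive side. *)
Lemma small_wall_sides :
  all (fun i => let: (x', y', z', w') := wall_residue i in
    all (fun x => all (fun y => all (fun z => all (fun w =>
      if wall (x, y, z, w) then
        gold_pos (- side_a (x, y, z, w)) || gold_pos (side_b (x, y, z, w))
      else true)
      [seq w <- gold_box | gold_mod2 w w'])
      [seq z <- gold_box | gold_mod2 z z'])
      [seq y <- gold_box | gold_mod2 y y'])
      [seq x <- gold_box | gold_mod2 x x']) (iota 0 4).
Proof. by vm_compute. Qed.

Lemma wall_sides x y z w : wall (x, y, z, w) ->
  x \in gold_box -> y \in gold_box -> z \in gold_box -> w \in gold_box ->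
  gold_pos (- side_a (x, y, z, w)) || gold_pos (side_b (x, y, z, w)).
Proof.
move=> wv xb yb zb wb.
have [i i4 vi] : exists2 i, i \in iota 0 4 & wall_mod2 i (x, y, z, w).
  move: wv => /andP[_] /or4P[] /andP[vi _]; [exists 0%N|exists 1%N|exists 2|exists 3] => //.
have := allP small_wall_sides i i4; move: vi; rewrite /wall_mod2.
case: (wall_residue i) => [[[x' y'] z'] w'] /and4P[xx yy zz ww].
have h r s : r \in gold_box -> gold_mod2 r s -> r \in [seq t <- gold_box | gold_mod2 t s].
  by move=> rb rs; rewrite mem_filter rs.
move=> /allP/(_ _ (h _ _ xb xx))/allP/(_ _ (h _ _ yb yy)).
by move=> /allP/(_ _ (h _ _ zb zz))/allP/(_ _ (h _ _ wb ww)); rewrite wv.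
Qed.

End GoldenLattice.

(** * Walls as planes of the Klein ball *)

Section Walls.
Variable R : realType.
Local Notation tau := (tau R).
Local Notation k := (klein_radius R ^+ 2).
Local Notation V := ('rV[R]_3 * R^o)%type.
Local Notation H3 := (H3 R).
Local Notation zt := (int * int)%type.
Local Notation lattice := (zt * zt * zt * zt)%type.
Implicit Types (r s : zt) (u v e f : lattice) (th : R).

Definition gold_val th r : R := r.1%:~R + r.2%:~R * th.

Lemma gold_valD th r s : gold_val th (r + s) = gold_val th r + gold_val th s.
Proof. by rewrite /gold_val /= !rmorphD /=; ring. Qed.

Lemma gold_valN th r : gold_val th (- r) = - gold_val th r.
Proof. by rewrite /gold_val /= !rmorphN /=; ring. Qed.

Lemma gold_valM th r s : th ^+ 2 = th + 1 ->
  gold_val th (gold_mul r s) = gold_val th r * gold_val th s.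
Proof.
move=> th2; rewrite /gold_val /= !(rmorphD, rmorphM) /=.
move: (_%:~R) (_%:~R) (_%:~R) (_%:~R) => a b c d.
by ring: th2.
Qed.

Definition emb v : V := let: (x, y, z, w) := v in
  (vec3 (gold_val tau x) (gold_val tau y) (gold_val tau z), gold_val tau w).

Let tau2 : tau ^+ 2 = tau + 1 := tau_sqr R.

Lemma embD u v : emb (u + v) = emb u + emb v.
Proof.
move: u v => [[[x y] z] w] [[[x' y'] z'] w']; congr pair; last exact: gold_valD.
by apply: row3P; rewrite !mxE /= gold_valD.
Qed.

Lemma embN v : emb (- v) = - emb v.
Proof.
move: v => [[[x y] z] w]; congr pair; last exact: gold_valN.
by apply: row3P; rewrite !mxE /= gold_valN.
Qed.

Lemma embZ r v : emb (lscale r v) = gold_val tau r *: emb v.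
Proof.
move: v => [[[x y] z] w]; congr pair; last exact: gold_valM.
by apply: row3P; rewrite !mxE /= gold_valM.
Qed.

Lemma lor_emb u v : lor (emb u) (emb v) = gold_val tau (lform u v).
Proof.
move: u v => [[[x y] z] w] [[[x' y'] z'] w'].
rewrite /lor /= dot_vec3 klein_radius_sqr !(gold_valD, gold_valN) !gold_valM //.
by rewrite [gold_val tau (1, 2)]/gold_val /=; ring.
Qed.

Lemma emb_lrot e f v : emb (lrot e f v) = rot90 (emb e) (emb f) (emb v).
Proof. by rewrite /lrot /rot90 !(embD, embN, embZ) !lor_emb. Qed.

Lemma lor_embE v (x : H3) : lor (emb v) (hpt x) =
  let: (x', y', z', w') := v in
  gold_val tau x' * \val x 0 0 + gold_val tau y' * \val x 0 1
  + gold_val tau z' * \val x 0 2%:R - k * gold_val tau w'.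
Proof.
by move: v => [[[x' y'] z'] w']; rewrite /lor dotE /= !mxE /= mulr1.
Qed.

(** The side of the wall v on which x lies, 0 meaning on the wall. *)
Definition side v (x : H3) : int := sgz (lor (emb v) (hyp x)).

Lemma sideE v x : side v x = sgz (lor (emb v) (hpt x)).
Proof. by rewrite /side lor_hypr sgzM gtr0_sgz ?mul1r // hyp_scale_gt0. Qed.

Lemma gold_trace r : gold_val tau r ^+ 2 + gold_val (1 - tau) r ^+ 2 =
  (gold_norm r)%:~R.
Proof.
rewrite /gold_val /gold_norm !(rmorphD, rmorphM) /=.
move: (_%:~R) (_%:~R) => a b.
by ring: tau2.
Qed.

Lemma wall_norm x y z w : wall (x, y, z, w) ->
  gold_val tau x ^+ 2 + gold_val tau y ^+ 2 + gold_val tau z ^+ 2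
    = 2 + (2 * tau + 1) * gold_val tau w ^+ 2.
Proof.
move=> /andP[/eqP /(congr1 (gold_val tau))].
rewrite /= !(gold_valD, gold_valN) !gold_valM //.
rewrite [gold_val _ (1, 2)]/gold_val [gold_val _ (2, 0)]/gold_val /=.
by move=> E _; move: E; rewrite mul0r; lra.
Qed.

Lemma wall_conj_norm x y z w : wall (x, y, z, w) ->
  gold_val (1 - tau) x ^+ 2 + gold_val (1 - tau) y ^+ 2
    + gold_val (1 - tau) z ^+ 2 + (2 * tau - 3) * gold_val (1 - tau) w ^+ 2 = 2.
Proof.
have sg2 : (1 - tau) ^+ 2 = (1 - tau) + 1 by rewrite sqrrB tau2; ring.
move=> /andP[/eqP /(congr1 (gold_val (1 - tau)))].
rewrite /= !(gold_valD, gold_valN) !gold_valM //.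
rewrite [gold_val _ (1, 2)]/gold_val [gold_val _ (2, 0)]/gold_val /=.
by move=> E _; move: E; rewrite mul0r; lra.
Qed.

(** The conjugate form is positive definite since the conjugate of - tau^3 is
    2 tau - 3 > 0, so the conjugates of the coordinates of all walls are bounded.
    This is the source of all finiteness below. *)
Lemma wall_conj_bound x y z w : wall (x, y, z, w) ->
  [/\ gold_val (1 - tau) x ^+ 2 <= 2, gold_val (1 - tau) y ^+ 2 <= 2,
      gold_val (1 - tau) z ^+ 2 <= 2 &
      gold_val (1 - tau) w ^+ 2 <= 2 * (2 * tau + 1)].
Proof.
move=> /wall_conj_norm.
have := sqr_ge0 (gold_val (1 - tau) x); have := sqr_ge0 (gold_val (1 - tau) y).
have := sqr_ge0 (gold_val (1 - tau) z); have := tau_gt R.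
have : 0 <= (2 * tau - 3) * gold_val (1 - tau) w ^+ 2.
  by rewrite mulr_ge0 ?sqr_ge0 //; have := tau_gt R; lra.
(* 2 tau + 1 is the inverse of 2 tau - 3 *)
have [c cE] : exists c, (2 * tau - 3) * gold_val (1 - tau) w ^+ 2 = c by eexists.
have wE : gold_val (1 - tau) w ^+ 2 = c * (2 * tau + 1) by rewrite -cE; ring: tau2.
rewrite cE wE; move: (_ ^+ 2) (_ ^+ 2) (_ ^+ 2) => x2 y2 z2.
by move=> ? ? ? ? ? ?; split; [lra|lra|lra|rewrite ler_pM2r; lra].
Qed.

End Walls.

(** * Counting the walls between two points *)

Section Crossings.
Variable R : realType.
Local Notation tau := (tau R).
Local Notation k := (klein_radius R ^+ 2).
Local Notation V := ('rV[R]_3 * R^o)%type.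
Local Notation H3 := (H3 R).
Local Notation zt := (int * int)%type.
Local Notation lattice := (zt * zt * zt * zt)%type.
Implicit Types (r s : zt) (v e f : lattice) (x y z : H3).

Local Notation side := (@side R).
Local Notation val := (gold_val tau).

Let tau2 : tau ^+ 2 = tau + 1 := tau_sqr R.

(** A golden integer with both embeddings bounded has bounded coordinates, as
    2 * gold_norm (a, b) = (2a + b)^2 + 5 b^2. *)
Lemma finite_gold_norm (N : nat) : finite_set [set r | gold_norm r <= N%:Z].
Proof.
pose box := [seq (i%:Z - (2 * N)%:Z, j%:Z - (2 * N)%:Z)
  | i <- iota 0 (4 * N).+1, j <- iota 0 (4 * N).+1].
apply: (@sub_finite_set _ _ [set` box]); last exact: finite_seq.
move=> [a b]; rewrite /gold_norm /= => ab.
have sq (c : int) : `|c| <= c * c by nia.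
have s1 := sq (2 * a + b); have s2 := sq b.
have sab : (2 * a + b) * (2 * a + b) + 5 * (b * b) <= 2 * N%:Z by nia.
have b0 : 0 <= b * b by rewrite -expr2 sqr_ge0.
have a0 : 0 <= (2 * a + b) * (2 * a + b) by rewrite -expr2 sqr_ge0.
have aN : `|a| <= 2 * N%:Z.
  by move: (b * b) (_ * _) sab b0 a0 s1 s2 {ab} => u w; lia.
have bN : `|b| <= 2 * N%:Z.
  by move: (b * b) (_ * _) sab b0 a0 s1 s2 {ab aN} => u w; lia.
apply/allpairsP; exists (`|(a + 2 * N%:Z)%R|%N, `|(b + 2 * N%:Z)%R|%N).
rewrite !mem_iota /=; split; [lia|lia|congr pair; lia].
Qed.

Lemma gold_norm_le r (c d : R) (N : nat) : val r ^+ 2 <= c ->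
  gold_val (1 - tau) r ^+ 2 <= d -> c + d < N.+1%:R -> gold_norm r <= N%:Z.
Proof.
move=> rc rd cdN; have E := gold_trace R r.
rewrite -ltzD1 -(ltr_int R) -E.
have -> : (N%:Z + 1)%:~R = N.+1%:R :> R by rewrite intrD -natr1.
by apply: le_lt_trans cdN; apply: lerD.
Qed.

(** Two numbers of different signs have a vanishing nontrivial combination with
    nonnegative coefficients: the wall meets the segment between the two points. *)
Lemma balance (c d : R) : sgz c != sgz d ->
  exists a b : R, [/\ 0 <= a, 0 <= b, 0 < a + b & a * c + b * d = 0].
Proof.
have [->|c0|c0] := sgzP c.
- by exists 1, 0; split; lra.
- have [->|d0|d0] := sgzP d => // _; first by exists 0, 1; split; lra.
  by exists (- d), c; split; lra.
- have [->|d0|d0] := sgzP d => // _; first by exists 0, 1; split; lra.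
  by exists d, (- c); split; lra.
Qed.

(** A wall separating x from y vanishes at a point of the segment from x to y, hence
    at distance at most the square root of rho < k from the origin. By the
    Cauchy-Schwarz inequality such a point bounds the last coordinate of a vector
    of norm 2, and then all its coordinates; their conjugates are always bounded. *)
Lemma separating_wall_bound x y : exists N : nat,
  forall r1 r2 r3 r4, wall (r1, r2, r3, r4) ->
  side (r1, r2, r3, r4) x != side (r1, r2, r3, r4) y ->
  [/\ gold_norm r1 <= N%:Z, gold_norm r2 <= N%:Z, gold_norm r3 <= N%:Z
    & gold_norm r4 <= N%:Z].
Proof.
have K0 := k_gt0 R.
pose rho := Num.max (dot (\val x) (\val x)) (dot (\val y) (\val y)).
have rhok : rho < k by rewrite gt_max (valP x) (valP y).
have xrho : dot (\val x) (\val x) <= rho by rewrite le_max lexx.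
have yrho : dot (\val y) (\val y) <= rho by rewrite le_max lexx orbT.
have rho0 : 0 <= rho := le_trans (dot_ge0 _) xrho.
have xyrho : dot (\val x) (\val y) <= rho.
  have := dot_cauchy (\val x) (\val y).
  have := dot_ge0 (\val x); have := dot_ge0 (\val y); nra.
have [C [C0 CE]] : exists C, 0 <= C /\ C = 2 * rho / (k * (k - rho)).
  by eexists; split; last reflexivity; apply: divr_ge0; apply: mulr_ge0; lra.
pose M := 2 + k * C + C + 2 + 2 * (2 * tau + 1).
have kC0 : 0 <= k * C by rewrite mulr_ge0 // ltW.
have t0 := tau_gt0 R.
exists (Num.bound M) => r1 r2 r3 r4 wv sv.
have MN : 2 + k * C + C + 2 + 2 * (2 * tau + 1) < (Num.bound M).+1%:R.
  by rewrite -/M -natr1 ltr_wpDr //; apply: archi_boundP; rewrite /M; lra.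
have [c1 c2 c3 c4] := wall_conj_bound R wv.
have nv := wall_norm R wv; rewrite -klein_radius_sqr in nv.
set v := (r1, r2, r3, r4) in wv sv *.
have n0 := sqr_ge0 (val r1); have n1 := sqr_ge0 (val r2); have n2 := sqr_ge0 (val r3).
suff w2 : val r4 ^+ 2 <= C.
  have kw2 : k * val r4 ^+ 2 <= k * C by rewrite ler_pM2l.
  clear -MN nv n0 n1 n2 c1 c2 c3 c4 w2 kw2 C0 kC0 t0.
  move: (Num.bound M) (k * C) kw2 kC0 MN nv => N kC kw2 kC0 MN nv.
  split; [| | |by apply: (@gold_norm_le _ C (2 * (2 * tau + 1))); lra];
    by apply: (@gold_norm_le _ (2 + kC) 2); lra.
move: sv; rewrite !sideE => /balance[a [b [a0 b0 ab0]]].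
have := dot_cauchy (emb R v).1 (a *: \val x + b *: \val y).
have -> : dot (emb R v).1 (emb R v).1 = 2 + k * val r4 ^+ 2.
  by rewrite dot_vec3 -!expr2.
have -> : dot (emb R v).1 (a *: \val x + b *: \val y) =
    a * lor (emb R v) (hpt x) + b * lor (emb R v) (hpt y)
    + k * val r4 * (a + b).
  by rewrite /lor !dotE !mxE /=; ring.
have -> : dot (a *: \val x + b *: \val y) (a *: \val x + b *: \val y) =
    a ^+ 2 * dot (\val x) (\val x) + 2 * (a * b) * dot (\val x) (\val y)
    + b ^+ 2 * dot (\val y) (\val y).
  by rewrite !dotE !mxE; ring.
move=> + ab; rewrite {}ab add0r => cauchy.
have {}cauchy : (k * val r4 * (a + b)) ^+ 2 <=
    (2 + k * val r4 ^+ 2) * (rho * (a + b) ^+ 2).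
  apply: le_trans cauchy _; apply: ler_wpM2l.
    by rewrite addr_ge0 // mulr_ge0 ?sqr_ge0 // ltW.
  have -> : rho * (a + b) ^+ 2 = a ^+ 2 * rho + 2 * (a * b) * rho + b ^+ 2 * rho.
    by ring.
  apply: lerD; first apply: lerD.
  - by rewrite ler_wpM2l ?sqr_ge0.
  - by rewrite ler_wpM2l // mulr_ge0 // mulr_ge0.
  - by rewrite ler_wpM2l ?sqr_ge0.
have {}cauchy : k ^+ 2 * val r4 ^+ 2 <= (2 + k * val r4 ^+ 2) * rho.
  rewrite -(@ler_pM2r _ ((a + b) ^+ 2)) ?exprn_gt0 //.
  by move: cauchy; rewrite !exprMn !mulrA.
rewrite CE ler_pdivlMr; last by rewrite mulr_gt0 // subr_gt0.
have -> : val r4 ^+ 2 * (k * (k - rho)) =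
  k ^+ 2 * val r4 ^+ 2 - k * val r4 ^+ 2 * rho by ring.
by rewrite lerBlDr -mulrDl.
Qed.

Lemma finite_separating_walls x y :
  finite_set [set v | wall v /\ side v x != side v y].
Proof.
have [N xyN] := separating_wall_bound x y.
have fN := finite_gold_norm N.
apply: sub_finite_set (finite_setX (finite_setX (finite_setX fN fN) fN) fN).
by move=> [[[r1 r2] r3] r4] /= [/xyN + sv] => /(_ sv)[].
Qed.

(** The signed number of walls crossed on the way from x to y, counted with weight
    two unless an end point lies on the wall. *)
Definition crossings x y : int :=
  \sum_(v \in [set v | wall v]) (side v y - side v x).

Lemma crossings_separating x y : crossings x y =
  \sum_(v \in [set v | wall v /\ side v x != side v y]) (side v y - side v x).
Proof.
apply/esym/fsbig_widen => [v []//|v /= [wv sep]].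
by apply: contra_notP sep => /eqP; rewrite subr_eq0 eq_sym.
Qed.

Lemma crossingsD x y z : crossings x z = crossings x y + crossings y z.
Proof.
pose D := [set v | wall v /\ side v x != side v y] `|`
          [set v | wall v /\ side v y != side v z].
have finD : finite_set D.
  by rewrite finite_setU; split; apply: finite_separating_walls.
have widen x' y' : (forall v, wall v -> ~ D v -> side v x' = side v y') ->
    crossings x' y' = \sum_(v \in D) (side v y' - side v x').
  move=> xyD; apply/esym/fsbig_widen => [v [[]|[]]//|v /= [wv nDv]].
  by rewrite (xyD v) ?subrr.
have Dxy v : wall v -> ~ D v -> side v x = side v y.
  by move=> wv nD; apply: contra_notP nD => /eqP xy; left.
have Dyz v : wall v -> ~ D v -> side v y = side v z.
  by move=> wv nD; apply: contra_notP nD => /eqP yz; right.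
rewrite !widen //; last by move=> v wv nD; rewrite Dxy // Dyz.
by rewrite -fsbig_split //; apply: eq_fsbigr => v _ /=; rewrite [RHS]addrC addrA subrK.
Qed.

Lemma crossingsxx x : crossings x x = 0.
Proof. by apply: fsbig1 => v _; rewrite subrr. Qed.

Lemma crossingsC x y : crossings y x = - crossings x y.
Proof. by apply/eqP; rewrite -addr_eq0 -crossingsD crossingsxx. Qed.

(** The sum is reindexed by sigma, a bijection of the walls since its fourth power
    is the identity. *)
Lemma crossings_equivariant (g : H3 -> H3) (sigma : lattice -> lattice) (s : int) :
  s = 1 \/ s = -1 ->
  (forall v, wall v -> wall (sigma v)) ->
  (forall v, sigma (sigma (sigma (sigma v))) = v) ->
  (forall v x, side (sigma v) (g x) = s * side v x) ->
  forall x y, crossings (g x) (g y) = s * crossings x y.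
Proof.
move=> s1 sw s4 sg x y.
have sigma_bij : set_bij [set v | wall v] [set v | wall v] sigma.
  split=> [v|u v _ _ /(congr1 (sigma \o sigma \o sigma))|v wv]; first exact: sw.
    by rewrite /= !s4.
  by exists (sigma (sigma (sigma v))); [exact: (sw _ (sw _ (sw _ wv)))|exact: s4].
apply: (etrans (reindex_fsbig sigma _ _ _ sigma_bij)).
transitivity (\sum_(v \in [set v | wall v]) (s * side v y - s * side v x)).
  by apply: eq_fsbigr => v _; rewrite !sg.
case: s1 => ->.
  by rewrite mul1r /crossings; apply: eq_fsbigr => v _; rewrite !mul1r.
rewrite mulN1r -crossingsC /crossings; apply: eq_fsbigr => v _.
by rewrite !mulN1r opprK addrC.
Qed.

End Crossings.

(** * The three axes *)

Section Axes.
Variable R : realType.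
Local Notation tau := (tau R).
Local Notation k := (klein_radius R ^+ 2).
Local Notation H3 := (H3 R).
Local Notation zt := (int * int)%type.
Local Notation lattice := (zt * zt * zt * zt)%type.
Local Notation emb := (@emb R).
Implicit Types (x y z : H3).

Let tau2 : tau ^+ 2 = tau + 1 := tau_sqr R.

Lemma emb_orthonormal_pair e f : lform e e = (1, 0) -> lform f f = (1, 0) ->
  lform e f = 0 -> orthonormal_pair (emb e) (emb f).
Proof.
move=> ee ff ef; split; rewrite lor_emb.
- by rewrite ee /gold_val /= mul0r addr0.
- by rewrite ff /gold_val /= mul0r addr0.
- by rewrite ef /gold_val /= mul0r addr0.
Qed.

Lemma orthonormal_a : orthonormal_pair (emb ea) (emb fa).
Proof. exact: emb_orthonormal_pair. Qed.

Lemma orthonormal_b : orthonormal_pair (emb eb) (emb fb).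
Proof. exact: emb_orthonormal_pair. Qed.

Lemma orthonormal_c : orthonormal_pair (emb ec) (emb fc).
Proof. exact: emb_orthonormal_pair. Qed.

(** The second vector of each polar pair cuts out the plane at distance tau from the
    origin. *)
Let slide (s : R) : tau * s - k * (tau - 1) = 0 <-> s = tau.
Proof.
rewrite klein_radius_sqr (_ : _ - _ = tau * (s - tau)); last by ring: tau2.
have t0 := lt0r_neq0 (tau_gt0 R); split=> [/eqP|->]; last by rewrite subrr mulr0.
by rewrite mulf_eq0 (negPf t0) subr_eq0 => /eqP.
Qed.

Lemma axis_aE : axis_a R = polar_line (emb ea) (emb fa).
Proof.
apply/seteqP; split=> [x [t xE]|x []].
  split; rewrite lorC lor_embE /gold_val /= xE !mxE /=; first by ring.
  by rewrite -[RHS]((slide tau).2 erefl); ring.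
rewrite !(lorC (hpt x)) !lor_embE /gold_val /=.
rewrite !(mul0r, mul1r, add0r, addr0, mulr0, subr0) => x1 x2.
exists (\val x 0 0); apply: row3P; rewrite !mxE /= ?mulr1 ?mulr0 ?addr0 ?add0r //.
by apply/slide; rewrite -x2; ring.
Qed.

Lemma axis_bE : axis_b R = polar_line (emb eb) (emb fb).
Proof.
apply/seteqP; split=> [x [t xE]|x []].
  split; rewrite lorC lor_embE /gold_val /= xE !mxE /=; first by ring.
  by rewrite -[RHS]((slide tau).2 erefl); ring.
rewrite !(lorC (hpt x)) !lor_embE /gold_val /=.
rewrite !(mul0r, mul1r, add0r, addr0, mulr0, subr0) => x1 x2.
exists (\val x 0 1); apply: row3P; rewrite !mxE /= ?mulr1 ?mulr0 ?addr0 ?add0r //.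
by apply/slide; rewrite -x2; ring.
Qed.

Lemma axis_cE : axis_c R = polar_line (emb ec) (emb fc).
Proof.
apply/seteqP; split=> [x [t xE]|x []].
  split; rewrite lorC lor_embE /gold_val /= xE !mxE /=; first by ring.
  by rewrite -[RHS]((slide tau).2 erefl); ring.
rewrite !(lorC (hpt x)) !lor_embE /gold_val /=.
rewrite !(mul0r, mul1r, add0r, addr0, mulr0, subr0) => x1 x2.
exists (\val x 0 2%:R); apply: row3P; rewrite !mxE /= ?mulr1 ?mulr0 ?addr0 ?add0r //.
by apply/slide; rewrite -x2; ring.
Qed.

Let tau_in_ball : tau ^+ 2 < k.
Proof. by rewrite klein_radius_sqr tau2; have := tau_gt0 R; lra. Qed.

Lemma exists_axis_point (p v : 'rV[R]_3) : dot p p < k ->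
  exists x : H3, \val x = p /\ line_through p v x.
Proof.
move=> pk; exists (exist (fun q : 'rV[R]_3 => is_true (dot q q < k)) p pk).
by split=> //; exists 0; rewrite scale0r addr0.
Qed.

Lemma axis_points : exists xa xb xc : H3,
  [/\ \val xa = vec3 0 0 tau /\ axis_a R xa, \val xb = vec3 tau 0 0 /\ axis_b R xb
    & axis_c R xc].
Proof.
have [xa xaP] : exists x : H3, \val x = vec3 0 0 tau /\ axis_a R x.
  by apply: exists_axis_point; rewrite dot_vec3 !mulr0 !add0r.
have [xb xbP] : exists x : H3, \val x = vec3 tau 0 0 /\ axis_b R x.
  by apply: exists_axis_point; rewrite dot_vec3 !mulr0 !addr0.
have [xc [_ xcP]] : exists x : H3, \val x = vec3 0 tau 0 /\ axis_c R x.
  by apply: exists_axis_point; rewrite dot_vec3 !mulr0 !(addr0, add0r).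
by exists xa, xb, xc.
Qed.

Lemma gold_pos_val r : gold_pos r -> 0 < gold_val tau r.
Proof.
case: r => a b /andP[/=]; rewrite -!(ltr_int R) !(rmorphD, rmorphM) /= /gold_val /=.
move: (a%:~R) (b%:~R) (tau_gt R) (tau_lt R) => c d t1 t2 h1 h2.
by have [d0|d0] := leP 0 d; nra.
Qed.

Lemma gold_box_val r (c d : R) : gold_val tau r ^+ 2 <= c ->
  gold_val (1 - tau) r ^+ 2 <= d -> c + d < 10 -> r \in gold_box.
Proof. by move=> rc rd cd; apply: gold_boxP; exact: (@gold_norm_le _ _ c d 9). Qed.

(** No wall is crossed in the negative direction between the two points, and x = z is
    crossed in the positive one. A wall crossed negatively would have
    tau^2 w^2 <= 2, which confines it to the finite box searched by
    small_wall_sides. *)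
Lemma crossings_axes (xa xb : H3) : \val xa = vec3 0 0 tau -> \val xb = vec3 tau 0 0 ->
  0 < crossings xa xb.
Proof.
move=> xaE xbE.
have sideaE v : side v xa = sgz (gold_val tau (side_a v)).
  rewrite sideE lor_embE; move: v => [[[r1 r2] r3] r4].
  rewrite xaE !mxE /= !mulr0 !add0r /side_a gold_valD gold_valN gold_valM //.
  rewrite [gold_val _ (1, 1)]/gold_val /= klein_radius_sqr.
  move: (gold_val _ _) (gold_val _ _) => s t.
  rewrite (_ : _ - _ = tau * (t - (1%:~R + 1%:~R * tau) * s)); last by ring: tau2.
  by rewrite sgzM gtr0_sgz ?mul1r // tau_gt0.
have sidebE v : side v xb = sgz (gold_val tau (side_b v)).
  rewrite sideE lor_embE; move: v => [[[r1 r2] r3] r4].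
  rewrite xbE !mxE /= !mulr0 !addr0 /side_b gold_valD gold_valN gold_valM //.
  rewrite [gold_val _ (1, 1)]/gold_val /= klein_radius_sqr.
  move: (gold_val _ _) (gold_val _ _) => s t.
  rewrite (_ : _ - _ = tau * (t - (1%:~R + 1%:~R * tau) * s)); last by ring: tau2.
  by rewrite sgzM gtr0_sgz ?mul1r // tau_gt0.
have le_ab v : wall v -> side v xa <= side v xb.
  move=> wv; rewrite leNgt; apply/negP => ba.
  have [a0 b0] : 0 <= gold_val tau (side_a v) /\ gold_val tau (side_b v) <= 0.
    rewrite -sgz_ge0 -sgz_le0 -sideaE -sidebE.
    have := @sgz_ge0 R; rewrite sideaE sidebE in ba *.
    by move: ba; case: sgzP; case: sgzP.
  move: v wv a0 b0 {ba} => [[[r1 r2] r3] r4] wv a0 b0.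
  have n := wall_norm R wv; have [c1 c2 c3 c4] := wall_conj_bound R wv.
  suff [b1 b2 b3 b4] : [/\ r1 \in gold_box, r2 \in gold_box, r3 \in gold_box
      & r4 \in gold_box].
    have /orP[] := wall_sides wv b1 b2 b3 b4 => /gold_pos_val.
      by rewrite gold_valN oppr_gt0 ltNge a0.
    by rewrite ltNge b0.
  move: a0 b0; rewrite /side_a /side_b !(gold_valD, gold_valN) !gold_valM //.
  rewrite ![gold_val _ (1, 1)]/gold_val /= => a0 b0.
  have t1 := tau_gt R; have t2 := tau_lt R.
  move: (sqr_ge0 (gold_val tau r1)) (sqr_ge0 (gold_val tau r2))
    (sqr_ge0 (gold_val tau r3)) (sqr_ge0 (gold_val tau r4)) => q1 q2 q3 q4.
  have sqE (s : R) : (s - (1%:~R + 1%:~R * tau) * gold_val tau r4)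
      * (s + (1%:~R + 1%:~R * tau) * gold_val tau r4)
      = s ^+ 2 - (2 * tau + 1) * gold_val tau r4 ^+ 2
        - (tau + 1) * gold_val tau r4 ^+ 2 by ring: tau2.
  (* one of |x|, |z| is at least tau^2 |w|, while x^2 + z^2 <= 2 + tau^3 w^2 *)
  have w2 : (tau + 1) * gold_val tau r4 ^+ 2 <= 2.
    have [w0|w0] := leP 0 (gold_val tau r4).
      have := mulr_ge0 a0 (_ : 0 <= gold_val tau r3
        + (1%:~R + 1%:~R * tau) * gold_val tau r4).
      rewrite sqE => h; have {}h := h ltac:(nra).
      by lra.
    have := mulr_le0 b0 (_ : gold_val tau r1
      + (1%:~R + 1%:~R * tau) * gold_val tau r4 <= 0).
    rewrite sqE => h; have {}h := h ltac:(nra).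
    by lra.
  have w2' : gold_val tau r4 ^+ 2 <= 10 / 13 by nra.
  clear -n c1 c2 c3 c4 q1 q2 q3 q4 w2 w2' t2.
  split; [| | |by apply: (@gold_box_val _ (10 / 13) (2 * (2 * tau + 1))); lra];
    by apply: (@gold_box_val _ 6 2); lra.
have v1w : wall ((1, 0), 0, (-1, 0), 0) by vm_compute.
have sep1 : side ((1, 0), 0, (-1, 0), 0) xa = -1
    /\ side ((1, 0), 0, (-1, 0), 0) xb = 1.
  rewrite sideaE sidebE /side_a /side_b /gold_val /=.
  by rewrite !mul0r !addr0 sgz1 sgzN1.
have [s1a s1b] := sep1.
rewrite crossings_separating (fsbigD1 ((1, 0), 0, (-1, 0), 0)); last first.
- by split=> //; rewrite s1a s1b.
- exact: finite_separating_walls.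
rewrite s1a s1b ltr_pwDl //.
by apply: fsumr_ge0 => v [[wv _] _]; rewrite subr_ge0; apply: le_ab.
Qed.

End Axes.

(** * Generators of U, their action on the walls, and conjugate rotations *)

Section BorromeanGroup.
Variable R : realType.
Local Notation tau := (tau R).
Local Notation V := ('rV[R]_3 * R^o)%type.
Local Notation H3 := (H3 R).
Local Notation zt := (int * int)%type.
Local Notation lattice := (zt * zt * zt * zt)%type.
Local Notation emb := (@emb R).
Implicit Types (g h : hisometry R) (x y z : H3) (e f : lattice).

Lemma hisometryK g : cancel g (g^-1)%g.
Proof. by move=> x; rewrite -[LHS]/((g^-1 * g)%g x) mulVg. Qed.

Lemma hisometryVK g : cancel (g^-1)%g g.
Proof. by move=> x; rewrite -[LHS]/((g * g^-1)%g x) mulgV. Qed.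

Definition lattice_turn e f g : Prop :=
  forall x, hyp (g x) = rot90 (emb e) (emb f) (hyp x).

Lemma lattice_turn_inj e f g h : lattice_turn e f g -> lattice_turn e f h -> g = h.
Proof. by move=> gt ht; apply: hisometry_ext => x; apply: hyp_inj; rewrite gt ht. Qed.

Lemma lattice_turnV e f g : orthonormal_pair (emb e) (emb f) ->
  lattice_turn f e g -> lattice_turn e f g^-1%g.
Proof.
move=> ef gt x; rewrite -{2}[x](hisometryVK g) gt rot90K //.
exact: orthonormal_pairC.
Qed.

Lemma quarter_turns e f (L : set H3) o : orthonormal_pair (emb e) (emb f) ->
  L = polar_line (emb e) (emb f) -> L o ->
  exists g, [/\ lattice_turn e f g, rotation90_about L g &
    forall h, rotation90_about L h -> h = g \/ h = g^-1%g].
Proof.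
move=> ef LE; rewrite {}LE => oL.
have [g [gt gL]] := exists_rotation90 ef oL; exists g; split=> // h.
move/(rotation90_aboutP ef oL) => [ht|ht]; [left|right].
  exact: lattice_turn_inj ht gt.
by rewrite -[h]invgK (lattice_turn_inj (lattice_turnV ef ht) gt).
Qed.

Lemma side_turn e f g v x : orthonormal_pair (emb e) (emb f) ->
  lattice_turn e f g -> side (lrot e f v) (g x) = side v x.
Proof. by move=> ef gt; rewrite /side gt emb_lrot rot90_isometry. Qed.

Lemma sideN v x : side (- v) x = - side v x.
Proof. by rewrite /side embN lorNl sgzN. Qed.

Lemma crossings_turn_a g : lattice_turn ea fa g ->
  forall x y, crossings (g x) (g y) = -1 * crossings x y.
Proof.
move=> gt; apply: (crossings_equivariant (sigma := fun v => - lrot ea fa v)).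
- by right.
- exact: wall_a.
- exact: lrot_a4.
- by move=> v x; rewrite sideN (side_turn _ _ (orthonormal_a R)) // mulN1r.
Qed.

Lemma crossings_turn_b g : lattice_turn eb fb g ->
  forall x y, crossings (g x) (g y) = -1 * crossings x y.
Proof.
move=> gt; apply: (crossings_equivariant (sigma := fun v => - lrot eb fb v)).
- by right.
- exact: wall_b.
- exact: lrot_b4.
- by move=> v x; rewrite sideN (side_turn _ _ (orthonormal_b R)) // mulN1r.
Qed.

Lemma crossings_turn_c g : lattice_turn ec fc g ->
  forall x y, crossings (g x) (g y) = 1 * crossings x y.
Proof.
move=> gt; apply: (crossings_equivariant (sigma := lrot ec fc)).
- by left.
- exact: wall_c.
- exact: lrot_c4.
- by move=> v x; rewrite (side_turn _ _ (orthonormal_c R)) // mul1r.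
Qed.

(** Enough of the linear action of an isometry to transport polar lines. *)
Definition lorentz_lift g (T : V -> V) : Prop :=
  (forall u v, lor (T u) (T v) = lor u v) /\ forall x, hyp (g x) = T (hyp x).

Lemma U_lift g : U R g -> exists T, lorentz_lift g T.
Proof.
move: g; suff UT : U R `<=` [set g | exists T T', [/\ cancel T T', cancel T' T & lorentz_lift g T]].
  by move=> g /UT[T [_ [_ _ gT]]]; exists T.
apply: generated_sub.
  split=> [|g h [T [T' [TK T'K [Tl gT]]]] [S [S' [SK S'K [Sl hS]]]]|g [T [T' [TK T'K [Tl gT]]]]].
  - by exists id, id.
  - exists (T \o S), (S' \o T'); split; [exact: can_comp|exact: can_comp|].
    by split=> [u v|x] /=; [rewrite Tl Sl|rewrite gT hS].
  - exists T', T; split=> //; split=> [u v|x]; first by rewrite -Tl !T'K.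
    by rewrite -{2}[x](hisometryVK g) gT TK.
have turn_lift e f (L : set H3) o g : orthonormal_pair (emb e) (emb f) ->
    L = polar_line (emb e) (emb f) -> L o -> rotation90_about L g ->
    exists T T', [/\ cancel T T', cancel T' T & lorentz_lift g T].
  move=> ef LE oL; rewrite LE in oL *; have fe := orthonormal_pairC ef.
  case/(rotation90_aboutP ef oL) => gt.
    exists (rot90 (emb e) (emb f)), (rot90 (emb f) (emb e)).
    by split; [exact: rot90K|exact: rot90K|split=> // u v; exact: rot90_isometry].
  exists (rot90 (emb f) (emb e)), (rot90 (emb e) (emb f)).
  by split; [exact: rot90K|exact: rot90K|split=> // u v; exact: rot90_isometry].
have [xa [xb [xc [[_ xaL] [_ xbL] xcL]]]] := axis_points R.
move=> g [ga|gb|gc].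
- exact: turn_lift (orthonormal_a R) (axis_aE R) xaL ga.
- exact: turn_lift (orthonormal_b R) (axis_bE R) xbL gb.
- exact: turn_lift (orthonormal_c R) (axis_cE R) xcL gc.
Qed.

(** Rotations whose axis is presented as a polar line; in this form the axis of a
    conjugate is the image of the polar pair under the lift. *)
Definition polar_rotation : set (hisometry R) := [set g |
  [/\ U R g, g <> 1%g & exists e f : V, [/\ orthonormal_pair e f,
     polar_line e f !=set0 & fixes_pointwise g (polar_line e f)]]].

Lemma polar_rotation_is_rotation : polar_rotation `<=` @is_rotation R.
Proof.
move=> g; case=> Ug g1 [e [f]] [ef efn gfix]; split=> //.
by exists (polar_line e f) => //; apply: polar_line_hline.
Qed.

Lemma polar_rotationJ u g : U R u -> polar_rotation g ->
  polar_rotation (u * g * u^-1)%g.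
Proof.
move=> Uu [Ug g1 [e [f [ef axis_nonempty gfix]]]].
have [ o oL] := axis_nonempty.
have Usub : is_subgroup (U R) := generated_subgroup _.
have [T [Tl uT]] := U_lift Uu.
have TL x : polar_line (T e) (T f) (u x) <-> polar_line e f x.
  by rewrite !polar_line_hyp uT !Tl.
split.
- apply: (subgroupM Usub); first exact: (subgroupM Usub).
  exact: (subgroupV Usub).
- move=> ug1; apply: g1; apply: (mulgI u); apply: (mulIg u^-1%g).
  by rewrite ug1 mulg1 mulgV.
- exists (T e), (T f); split; first by case: ef => *; split; rewrite Tl.
    by exists (u o); apply/TL.
  move=> y; rewrite -{1}[y](hisometryVK u) => /TL yL.
  by rewrite -[LHS]/(u (g (u^-1%g y))) (gfix _ yL) hisometryVK.
Qed.

End BorromeanGroup.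

(** * Subgroups of every index *)

Theorem theorem7 (R : realType) (n : nat) (hn : (0 < n)%N) :
  exists G : set (hisometry R),
    [/\ is_subgroup G, G `<=` U R, has_index (U R) G n
      & generated_by_rotations G].
Proof.
have [xa [xb [xc [[xaE xaL] [xbE xbL] xcL]]]] := axis_points R.
have m0 : 0 < crossings xa xb := crossings_axes xaE xbE.
have [a [at90 aL aP]] := quarter_turns (orthonormal_a R) (axis_aE R) xaL.
have [b [bt90 bL bP]] := quarter_turns (orthonormal_b R) (axis_bE R) xbL.
have [c [ct90 cL cP]] := quarter_turns (orthonormal_c R) (axis_cE R) xcL.
have aR := crossings_turn_a at90; have bR := crossings_turn_b bt90.
have cR := crossings_turn_c ct90.
(* the sign by which g acts on the walls *)
pose rescales (g : hisometry R) (s : int) :=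
  forall x y, crossings (g x) (g y) = s * crossings x y.
pose m2 : int := 2 * crossings xa xb.
have m2_neq0 : m2 != 0 by rewrite /m2; lia.
pose compatible (g : hisometry R) := exists s : int,
  [/\ s = 1 \/ s = -1, rescales g s & (m2 %| crossings xa (g xa))%Z].
have rescalesV (g : hisometry R) (s : int) : s = 1 \/ s = -1 -> rescales g s -> rescales g^-1%g s.
  move=> s1 gs x y.
  rewrite -[in RHS](hisometryVK g x) -[in RHS](hisometryVK g y) gs mulrA.
  by case: s1 => ->; rewrite ?mulrNN !mul1r.
have compat_sub : is_subgroup compatible.
  split=> [|g h [s [s1 gs gm]] [s' [s1' hs hm]]|g [s [s1 gs gm]]].
  - by exists 1; split; [left|move=> x y; rewrite mul1r|rewrite crossingsxx dvdz0].
  - exists (s * s'); split; first by lia.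
      by move=> x y; rewrite -mulrA -hs -gs.
    by rewrite (crossingsD _ (g xa)) [X in _ + X]gs rpredD // dvdz_mull.
  - exists s; split=> //; first exact: rescalesV.
    have := rescalesV _ _ s1 gs (g xa) xa; rewrite hisometryK => ->.
    by rewrite crossingsC mulrN rpredN dvdz_mull.
(* an isometry with a fixed point x acts on the integers as a reflection or trivially *)
have translation (g : hisometry R) x : g x = x -> forall s : int, rescales g s ->
    crossings xa (g xa) = (1 - s) * crossings xa x.
  move=> gx s gs; rewrite (crossingsD _ x) -{2}gx gs crossingsC; ring.
have a_xa : a xa = xa by apply: aL.1.
have b_xb : b xb = xb by apply: bL.1.
have c_xc : c xc = xc by apply: cL.1.
have ta := translation _ _ a_xa _ aR; have tb := translation _ _ b_xb _ bR.
rewrite crossingsxx mulr0 in ta; rewrite opprK -/m2 in tb.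
have gen_a g : rotation90_about (axis_a R) g -> compatible g.
  have compat_a : compatible a by exists (-1); rewrite ta dvdz0; split=> //; right.
  by move=> /aP[->|->]; [exact: compat_a|exact: (subgroupV compat_sub)].
have gen_b g : rotation90_about (axis_b R) g -> compatible g.
  have compat_b : compatible b by exists (-1); rewrite tb dvdzz; split=> //; right.
  by move=> /bP[->|->]; [exact: compat_b|exact: (subgroupV compat_sub)].
have gen_c g : rotation90_about (axis_c R) g ->
    rescales g 1 /\ crossings xa (g xa) = 0.
  move=> gc; have gR : rescales g 1.
    by case: (cP g gc) => -> //; apply: rescalesV => //; left.
  by split=> //; rewrite (translation _ _ (gc.1 _ xcL) _ gR) subrr mul0r.
have compatU g : U R g -> compatible g.
  move: g; apply: generated_sub => // g [/gen_a|/gen_b|/gen_c[gR g0]] //.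
  by exists 1; rewrite g0 dvdz0; split=> //; left.
(* the linear part and the translation part of the action on Z *)
pose e (g : hisometry R) : int := if `[< rescales g 1 >] then 1 else -1.
pose t (g : hisometry R) : int := (crossings xa (g xa) %/ m2)%Z.
have eE (g : hisometry R) (s : int) : s = 1 \/ s = -1 -> rescales g s -> e g = s.
  move=> s1 gs; rewrite /e; case: asboolP => [g1|gN1].
    by have := g1 xa xb; rewrite gs; case: s1 => -> //; lia.
  by case: s1 => sE //; case: gN1; rewrite -sE.
have eR g : U R g -> rescales g (e g).
  by move=> /compatU[s [s1 gs _]]; rewrite (eE g s).
have tE g : U R g -> t g * m2 = crossings xa (g xa).
  by move=> /compatU[s [_ _ /divzK]].
have Usub : is_subgroup (U R) := generated_subgroup _.
have UM := subgroupM Usub.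
have Ua : U R a by apply: sub_generated; apply: Or31.
have Ub : U R b by apply: sub_generated; apply: Or32.
have tM g h : U R g -> U R h -> t (g * h)%g = t g + e g * t h.
  move=> Ug Uh; apply: (mulIf m2_neq0).
  rewrite mulrDl -mulrA !tE //; last exact: UM.
  by rewrite (crossingsD _ (g xa)) -eR.
have eM g h : U R g -> U R h -> e (g * h)%g = e g * e h.
  move=> Ug Uh; have [s [s1 gs _]] := compatU _ Ug.
  have [s' [s1' hs _]] := compatU _ Uh.
  rewrite (eE g s) // (eE h s') //; apply: eE; first by lia.
  by move=> x y; rewrite -mulrA -hs -gs.
have ea : e a = -1 by apply: eE => //; right.
have eb : e b = -1 by apply: eE => //; right.
have e1 : e 1%g = 1 by apply: eE => [|x y]; [left|rewrite mul1r].
have t_a : t a = 0 by rewrite /t ta div0z.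
have t_b : t b = 1 by rewrite /t tb divzz m2_neq0.
have rot_or1 g (L : set (H3 R)) e' f' : U R g -> orthonormal_pair e' f' ->
    L = polar_line e' f' -> L !=set0 -> fixes_pointwise g L ->
    g = 1%g \/ polar_rotation g.
  move=> Ug ef LE L0 gL; have [g1|g1] := pselect (g = 1%g); [by left|right].
  by split=> //; exists e', f'; rewrite -LE.
have L0a : axis_a R !=set0 by exists xa.
have L0b : axis_b R !=set0 by exists xb.
have L0c : axis_c R !=set0 by exists xc.
have rota : polar_rotation a.
  have [a1|//] := rot_or1 a _ _ _ Ua (orthonormal_a R) (axis_aE R) L0a aL.1.
  by move: ea; rewrite a1 e1.
have rotb : polar_rotation b.
  have [b1|//] := rot_or1 b _ _ _ Ub (orthonormal_b R) (axis_bE R) L0b bL.1.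
  by move: eb; rewrite b1 e1.
have fix2 (g : hisometry R) L : fixes_pointwise g L -> fixes_pointwise (g * g)%g L.
  by move=> gL x xL; rewrite -[LHS]/(g (g x)) !gL.
have rotaa := rot_or1 _ _ _ _ (UM _ _ Ua Ua) (orthonormal_a R) (axis_aE R) L0a
  (fix2 _ _ aL.1).
have rotbb := rot_or1 _ _ _ _ (UM _ _ Ub Ub) (orthonormal_b R) (axis_bE R) L0b
  (fix2 _ _ bL.1).
have rotU : @polar_rotation R `<=` U R by move=> g [].
have gensP (g : hisometry R) :
    [\/ rotation90_about (axis_a R) g, rotation90_about (axis_b R) g
      | rotation90_about (axis_c R) g] ->
    [\/ g = a \/ g = a^-1%g, g = b \/ g = b^-1%g
      | [/\ g = 1%g \/ polar_rotation g, t g = 0 & e g = 1]].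
  move=> gg; have Ug : U R g by apply: sub_generated.
  case: gg => [/aP gE|/bP gE|gc]; [exact: Or31|exact: Or32|apply: Or33].
  have [gR g0] := gen_c g gc; split.
  - exact: (rot_or1 _ _ _ _ Ug (orthonormal_c R) (axis_cE R) L0c gc.1).
  - by rewrite /t g0 div0z.
  - by apply: eE => //; left.
have [G [Gsub GU Gn GE]] := dihedral_index_subgroup tM eM rotU (@polar_rotationJ R)
  rota rotb t_a ea t_b eb rotaa rotbb gensP hn.
exists G; split=> //; apply/seteqP; split; last first.
  by apply: generated_sub => // g [].
rewrite {1}GE; apply: sub_smallest2r; first exact: generated_subgroup.
by move=> g [Gg /polar_rotation_is_rotation].
Qed.
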